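(* Let $A$ and $B$ be 0-1 matrices of sizes $p\times q$ and $q\times r$, respectively. Given parameters $\ell\in[p]$ and $k\in[r]$, the arithmetic matrix product $AB$ can be computed by a deterministic algorithm in time $$O\big(pq\ell+rqk+\min\{pr\,\lambda(A,\ell,\mathrm{row})+rq\ell,\; pr\,\lambda(B,k,\mathrm{col})+pqk\}\big).$$
   Context: For a positive integer $r$, $[r]=\{1,\dots,r\}$. The arithmetic matrix product $C=AB$ has entries $C_{ij}=\sum_{h=1}^q A_{ih}B_{hj}$ (over the integers). The Hamming distance $\mathrm{ham}(a,b)$ between $a,b\in\{0,1\}^q$ is the number of coordinates in which they differ. For a 0-1 $p\times q$ matrix $A$, $\lambda(A,\ell,\mathrm{row})$ is the minimum, over all sets $T$ of $\ell$ points of $\{0,1\}^q$, of $\max_{i\in[p]}\min_{u\in T}\mathrm{ham}(A_{i*},u)$, where $A_{i*}$ is the $i$-th row of $A$. For a 0-1 $q\times r$ matrix $B$, $\lambda(B,k,\mathrm{col})$ is the analogous minimum over sets of $k$ points of $\{0,1\}^q$ of the maximum Hamming distance from a column of $B$ to its closest point in the set. Running times are in the standard RAM model.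
   Formalization: The time bound has an extra additive term pr for writing the output; without it the claim fails (q = ℓ = k = 1, all-ones A and B: λ = 0, bound O(p+r), but pr nonzero entries). λ is taken over sets of at most ℓ (resp. k) points, so it is defined also when ℓ or k exceeds 2^q. *)

(* Defs.v *)
From mathcomp Require Import all_boot all_algebra.
Set Implicit Arguments.
Unset Strict Implicit.
Unset Printing Implicit Defensive.

Definition arith_prod_entry (p q r : nat) (A : 'M[bool]_(p, q))
  (B : 'M[bool]_(q, r)) (i : 'I_p) (j : 'I_r) : nat :=
  \sum_(h < q) ((A i h : nat) * (B h j : nat)).

Definition ham (q : nat) (u v : 'I_q -> bool) : nat :=
  #|[pred h : 'I_q | u h != v h]|.

(* lambda(A, l, row): min over sets T of (at most) l points of {0,1}^q of
   max_i min_{u in T} ham(A_{i*}, u).  q is used as the unit of [minn]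
   (every Hamming distance is <= q). *)
Definition lambda_row (p q : nat) (A : 'M[bool]_(p, q)) (l : nat) : nat :=
  \big[minn/q]_(T : {set {ffun 'I_q -> bool}} | #|T| <= l)
     \max_(i < p) \big[minn/q]_(u in T) ham (fun h => A i h) u.

Definition lambda_col (q r : nat) (B : 'M[bool]_(q, r)) (k : nat) : nat :=
  \big[minn/q]_(T : {set {ffun 'I_q -> bool}} | #|T| <= k)
     \max_(j < r) \big[minn/q]_(u in T) ham (fun h => B h j) u.

(* Registers (direct addressing, finitely many used by a program) and a
   main memory (indirect addressing through registers).  All values are
   words in [0, W): arithmetic is modulo W (subtraction is truncated,
   division is floor division, x / 0 = 0).  Each executed instruction
   costs one time unit. *)

Inductive instr : Type :=
| IConst of nat & nat
| IAdd   of nat & nat & nat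
| ISub   of nat & nat & nat
| IMul   of nat & nat & nat
| IDiv   of nat & nat & nat
| ILoad  of nat & nat
| IStore of nat & nat
| IJz    of nat & nat
| IHalt.

Definition program := seq instr.

Definition upd (f : nat -> nat) (a v : nat) : nat -> nat :=
  fun x => if x == a then v else f x.

Record config := Config { pc : nat; regs : nat -> nat; mem : nat -> nat }.

Definition step (W : nat) (i : instr) (c : config) : config :=
  let: Config n R M := c in
  match i with
  | IConst d v   => Config n.+1 (upd R d (v %% W)) M
  | IAdd d a b   => Config n.+1 (upd R d ((R a + R b) %% W)) M
  | ISub d a b   => Config n.+1 (upd R d (R a - R b)) M
  | IMul d a b   => Config n.+1 (upd R d ((R a * R b) %% W)) M
  | IDiv d a b   => Config n.+1 (upd R d (R a %/ R b)) M
  | ILoad d a    => Config n.+1 (upd R d (M (R a))) M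
  | IStore a s   => Config n.+1 R (upd M (R a) (R s))
  | IJz a t      => Config (if R a == 0 then t else n.+1) R M
  | IHalt        => Config n R M
  end.

(* [exec P W t c] = Some M iff, started in configuration c, the program
   P halts (reaches IHalt, or a pc outside P) after at most t steps,
   with final main memory M. *)
Fixpoint exec (P : program) (W : nat) (t : nat) (c : config)
  : option (nat -> nat) :=
  match nth IHalt P (pc c) with
  | IHalt => Some (mem c)
  | i => match t with
         | 0 => None
         | t'.+1 => exec P W t' (step W i c)
         end
  end.

(* Input encoding: registers 0..4 hold p, q, r, l, k; all other registers
   are 0.  Main memory holds A row-major at addresses [0, pq), B row-major
   at [pq, pq+qr); all other cells are 0. *)
Definition init_regs (p q r l k : nat) : nat -> nat :=
  fun a => if a == 0 then p else if a == 1 then q else if a == 2 then r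
           else if a == 3 then l else if a == 4 then k else 0.

Definition init_mem (p q r : nat) (A : 'M[bool]_(p, q)) (B : 'M[bool]_(q, r))
  : nat -> nat :=
  fun a =>
    if a < p * q then
      ([exists i : 'I_p, exists h : 'I_q, (a == i * q + h) && A i h] : nat)
    else if a < p * q + q * r then
      ([exists h : 'I_q, exists j : 'I_r,
          (a == p * q + h * r + j) && B h j] : nat)
    else 0.

Definition init_config p q r (A : 'M[bool]_(p, q)) (B : 'M[bool]_(q, r)) l k :=
  Config 0 (init_regs p q r l k) (init_mem A B).

Definition out_addr (p q r : nat) (i j : nat) : nat := p * q + q * r + i * r + j.

(* Word size: words are integers in [0, (n+2)^c), n = p q + q r + p r the
   size of input + output, i.e. Theta(log n)-bit words for a constant c. *)
Definition word_bound (c p q r : nat) : nat := (p * q + q * r + p * r + 2) ^ c.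

(* The time bound of Theorem 5 (plus the output size pr). *)
Definition time_bound p q r (A : 'M[bool]_(p, q)) (B : 'M[bool]_(q, r)) l k :=
  p * r + p * q * l + r * q * k
  + minn (p * r * lambda_row A l + r * q * l) (p * r * lambda_col B k + p * q * k).

(* Main.v *)
Require Import Defs.
From mathcomp Require Import all_boot all_algebra.
From mathcomp Require Import zify.
Set Implicit Arguments.
Unset Strict Implicit.
Unset Printing Implicit Defensive.

(** Farthest-first traversal of the rows of [A] yields [l] of them such that every
    row is within [2 * lambda_row A l] of one of these: otherwise the traversal
    would exhibit [l + 1] rows pairwise further apart than [2 * lambda_row A l], two of
    which share a centre of an optimal solution. The products of the chosen rows
    with [B] are computed directly in time [q r l]; every other row of [A B] is
    obtained from that of its chosen neighbour, at a cost of [r] per coordinate in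
    which the two rows of [A] differ. The columns of [B] are treated symmetrically,
    and the traversals yield the two radii, so that the machine can compare the
    costs beforehand. *)

(** * A structured language compiled to the machine *)

(** The traversals cost $pq\ell$ and $rqk$, the two terms outside the minimum. The values [lambda]
    are never computed: the radii found replace them, at the price of a factor 2 absorbed by the
    constant. The machine shapes the rest. Its memory starts at 0, so a distance $d$ is stored as
    $q+1-d$: an untouched cell then means infinitely far, and no table has to be initialised.
    Subtraction is truncated and the only jump is on zero, so a comparison is a subtraction followed
    by a test. Loops test after their body, which forces the case $q=0$ to be set apart. Values must
    never wrap around, which bounds the word size from below by the estimated costs. Correctness and
    running time are proved together, in a program logic whose loop rule adds up bounds that depend
    on the iteration. A uniform bound per coordinate would charge $rq$ for the correction of a row;
    the sum charges $r$ times the Hamming distance. *)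

Inductive expr : Type :=
| EVar of nat
| ECst of nat
| EAdd of expr & expr
| ESub of expr & expr
| EMul of expr & expr
| ELd of expr.

(* [Do c e] repeats [c] until the value of [e] is nonzero, since the only jump of the
   machine is a jump on zero. *)
Inductive cmd : Type :=
| Asg of nat & expr
| Sto of expr & expr
| Seq of cmd & cmd
| When of expr & cmd
| Do of cmd & expr.

Declare Scope exp_scope.
Delimit Scope exp_scope with E.
Bind Scope exp_scope with expr.
Notation "a + b" := (EAdd a b) : exp_scope.
Notation "a - b" := (ESub a b) : exp_scope.
Notation "a * b" := (EMul a b) : exp_scope.
Notation "'$' v" := (EVar v) (at level 1, v at level 1, format "$ v") : exp_scope.
Notation "'#' v" := (ECst v) (at level 1, v at level 1, format "# v") : exp_scope.
Notation "c ;; d" := (Seq c d) (at level 60, right associativity).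

(* Registers from 100 on are the evaluation stack of expressions. *)
Definition tmp := 100.

(* Subtracting [0] copies a register without reducing it modulo [W]. *)
Fixpoint comp_expr (t : nat) (e : expr) : seq instr :=
  match e with
  | EVar v => [:: IConst t 0; ISub t v t]
  | ECst n => [:: IConst t n]
  | EAdd a b => comp_expr t a ++ comp_expr t.+1 b ++ [:: IAdd t t t.+1]
  | ESub a b => comp_expr t a ++ comp_expr t.+1 b ++ [:: ISub t t t.+1]
  | EMul a b => comp_expr t a ++ comp_expr t.+1 b ++ [:: IMul t t t.+1]
  | ELd a => comp_expr t a ++ [:: ILoad t t]
  end.

Fixpoint esize (e : expr) : nat :=
  match e with
  | EVar _ => 2
  | ECst _ => 1
  | EAdd a b | ESub a b | EMul a b => esize a + esize b + 1
  | ELd a => esize a + 1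
  end.

Fixpoint csize (c : cmd) : nat :=
  match c with
  | Asg _ e => esize e + 2
  | Sto a e => esize a + esize e + 1
  | Seq c d => csize c + csize d
  | When e c => esize e + 1 + csize c
  | Do c e => csize c + esize e + 1
  end.

Fixpoint compile (b : nat) (c : cmd) : seq instr :=
  match c with
  | Asg d e => comp_expr tmp e ++ [:: IConst tmp.+1 0; ISub d tmp tmp.+1]
  | Sto a e => comp_expr tmp a ++ comp_expr tmp.+1 e ++ [:: IStore tmp tmp.+1]
  | Seq c d => compile b c ++ compile (b + csize c) d
  | When e c => comp_expr tmp e ++ IJz tmp (b + csize (When e c))
                  :: compile (b + esize e + 1) c
  | Do c e => compile b c ++ comp_expr tmp e ++ [:: IJz tmp b]
  end.

Lemma size_comp_expr t e : size (comp_expr t e) = esize e.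
Proof.
by elim: e t => //= [a IHa b IHb|a IHa b IHb|a IHa b IHb|a IHa] t;
  rewrite !size_cat ?IHa ?IHb /=; lia.
Qed.

Lemma size_compile b c : size (compile b c) = csize c.
Proof.
elim: c b => [d e|a e|c IHc d IHd|e c IHc|c IHc e] b /=;
  rewrite !size_cat ?IHc ?IHd ?size_comp_expr /= ?IHc; lia.
Qed.

(** * Semantics of expressions and runs of the machine *)

Fixpoint eval (rg M : nat -> nat) (e : expr) : nat :=
  match e with
  | EVar v => rg v
  | ECst n => n
  | EAdd a b => eval rg M a + eval rg M b
  | ESub a b => eval rg M a - eval rg M b
  | EMul a b => eval rg M a * eval rg M b
  | ELd a => M (eval rg M a)
  end.

(* Evaluation never wraps around modulo [W]. *)
Fixpoint ok (W : nat) (rg M : nat -> nat) (e : expr) : Prop :=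
  match e with
  | EVar v => v < tmp
  | ECst n => n < W
  | EAdd a b => [/\ ok W rg M a, ok W rg M b & eval rg M a + eval rg M b < W]
  | ESub a b => ok W rg M a /\ ok W rg M b
  | EMul a b => [/\ ok W rg M a, ok W rg M b & eval rg M a * eval rg M b < W]
  | ELd a => ok W rg M a
  end.

Definition frag (P : program) (b : nat) (s : seq instr) : Prop :=
  forall i, i < size s -> nth IHalt P (b + i) = nth IHalt s i.

Lemma frag_cat P b s1 s2 :
  frag P b (s1 ++ s2) -> frag P b s1 /\ frag P (b + size s1) s2.
Proof.
move=> F; split=> i Hi.
  by rewrite F ?nth_cat ?Hi // size_cat ltn_addr.
rewrite -addnA F ?size_cat ?ltn_add2l // nth_cat ltnNge leq_addr /=.
by rewrite addKn.
Qed.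

Lemma frag_cons P b i s : frag P b (i :: s) -> nth IHalt P b = i /\ frag P b.+1 s.
Proof.
move=> F; split; first by have := F 0 isT; rewrite addn0.
by move=> j Hj; have := F j.+1 Hj; rewrite addnS addSn.
Qed.

Definition agree (R rg : nat -> nat) : Prop := forall x, x < tmp -> R x = rg x.

Definition halts_here (i : instr) : bool := if i is IHalt then true else false.

Lemma exec_step P W t i c : nth IHalt P (pc c) = i -> ~~ halts_here i ->
  exec P W t.+1 c = exec P W t (step W i c).
Proof. by move=> /= ->; case: i. Qed.

(** Quantifying over the remaining fuel [T] makes runs compose by adding their times. *)
Definition reaches P W b (R M : nat -> nat) t b' R' M' : Prop :=
  forall T, exec P W (t + T) (Config b R M) = exec P W T (Config b' R' M').

Lemma reaches_trans P W b1 R1 M1 t1 b2 R2 M2 t2 b3 R3 M3 :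
  reaches P W b1 R1 M1 t1 b2 R2 M2 -> reaches P W b2 R2 M2 t2 b3 R3 M3 ->
  reaches P W b1 R1 M1 (t1 + t2) b3 R3 M3.
Proof. by move=> H1 H2 T; rewrite -addnA H1 H2. Qed.

Lemma reaches_step P W b R M i : nth IHalt P b = i -> ~~ halts_here i ->
  reaches P W b R M 1 (pc (step W i (Config b R M)))
    (regs (step W i (Config b R M))) (Defs.mem (step W i (Config b R M))).
Proof.
move=> E Hi T; rewrite add1n (@exec_step _ _ _ i) //.
by case: (step _ _ _).
Qed.

Lemma reaches_cast P W b R M t t' b1 b2 R' M' :
  reaches P W b R M t b1 R' M' -> t = t' -> b1 = b2 -> reaches P W b R M t' b2 R' M'.
Proof. by move=> H <- <-. Qed.

Lemma upd_same f a v : upd f a v a = v.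
Proof. by rewrite /upd eqxx. Qed.

Lemma upd_other f a v x : x != a -> upd f a v x = f x.
Proof. by rewrite /upd => /negbTE ->. Qed.

(** Stack discipline: evaluation at level [t] leaves every register below [t] alone, so a left
    operand waits in [t] while the right one is evaluated from [t.+1] on. *)
Lemma comp_expr_correct P W b t R rg M e :
  frag P b (comp_expr t e) -> tmp <= t -> agree R rg -> ok W rg M e ->
  exists R', [/\ R' t = eval rg M e, forall x, x < t -> R' x = R x &
    reaches P W b R M (esize e) (b + esize e) R' M].
Proof.
(* The binary operations differ only in their last instruction [i]. *)
have bin (a1 a2 : expr) i t0 b0 R0 v :
  (forall b t R, frag P b (comp_expr t a1) -> tmp <= t -> agree R rg ->
    exists R', [/\ R' t = eval rg M a1, forall x, x < t -> R' x = R x &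
    reaches P W b R M (esize a1) (b + esize a1) R' M]) ->
  (forall b t R, frag P b (comp_expr t a2) -> tmp <= t -> agree R rg ->
    exists R', [/\ R' t = eval rg M a2, forall x, x < t -> R' x = R x &
    reaches P W b R M (esize a2) (b + esize a2) R' M]) ->
  frag P b0 (comp_expr t0 a1 ++ comp_expr t0.+1 a2 ++ [:: i]) ->
  tmp <= t0 -> agree R0 rg -> ~~ halts_here i ->
  (forall R', R' t0 = eval rg M a1 -> R' t0.+1 = eval rg M a2 ->
    forall k, step W i (Config k R' M) = Config k.+1 (upd R' t0 v) M) ->
  exists R', [/\ R' t0 = v, forall x, x < t0 -> R' x = R0 x &
    reaches P W b0 R0 M (esize a1 + esize a2 + 1)
       (b0 + (esize a1 + esize a2 + 1)) R' M].
  move=> IH1 IH2 /frag_cat[F1]; rewrite size_comp_expr => /frag_cat[F2].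
  rewrite size_comp_expr => /frag_cons[F3 _] Ht A0 Hi Hs.
  have [R1 [V1 O1 X1]] := IH1 _ _ _ F1 Ht A0.
  have A1 : agree R1 rg by move=> x Hx; rewrite O1 ?A0 //; apply: leq_trans Ht.
  have [R2 [V2 O2 X2]] := IH2 _ _ _ F2 (leqW Ht) A1.
  have X3 := @reaches_step P W _ R2 M _ F3 Hi.
  rewrite Hs // ?O2 // in X3.
  exists (upd R2 t0 v); split; first by rewrite upd_same.
    by move=> x Hx; rewrite upd_other ?O2 ?O1 ?ltn_eqF // ltnS ltnW.
  have := reaches_trans (reaches_trans X1 X2) X3.
  by rewrite /= -!addnS -!addnA addn1.
elim: e b t R => [v|n|a IHa c IHc|a IHa c IHc|a IHa c IHc|a IHa] b t R F Ht A /=.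
- move=> Hv; move: F => /= /frag_cons[F1 /frag_cons[F2 _]].
  have X1 := @reaches_step P W _ R M _ F1 isT.
  have X2 := @reaches_step P W _ (upd R t (0 %% W)) M _ F2 isT.
  eexists; split; last first.
  + have := reaches_trans X1 X2; rewrite /= addn2; exact.
  + move=> x Hx; rewrite !upd_other //; lia.
  + by rewrite upd_same upd_other ?upd_same ?mod0n ?subn0 ?A //; lia.
- move=> Hn; move: F => /= /frag_cons[F1 _].
  eexists; split; last first.
  + have := @reaches_step P W _ R M _ F1 isT; rewrite /= addn1; exact.
  + move=> x Hx; rewrite !upd_other //; lia.
  + by rewrite upd_same modn_small.
- case=> Ka Kc K; apply: (bin _ _ _ _ _ _ _ _ _ F) => //.
  + by move=> *; apply: IHa.
  + by move=> *; apply: IHc.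
  + by move=> R' V1 V2 k /=; rewrite V1 V2 modn_small.
- case=> Ka Kc; apply: (bin _ _ _ _ _ _ _ _ _ F) => //.
  + by move=> *; apply: IHa.
  + by move=> *; apply: IHc.
  + by move=> R' V1 V2 k /=; rewrite V1 V2.
- case=> Ka Kc K; apply: (bin _ _ _ _ _ _ _ _ _ F) => //.
  + by move=> *; apply: IHa.
  + by move=> *; apply: IHc.
  + by move=> R' V1 V2 k /=; rewrite V1 V2 modn_small.
- move=> Ka; move: F => /= /frag_cat[F1]; rewrite size_comp_expr => /frag_cons[F2 _].
  have [R1 [V1 O1 X1]] := IHa _ _ _ F1 Ht A Ka.
  have X2 := @reaches_step P W _ R1 M _ F2 isT.
  eexists; split; last first.
  + have := reaches_trans X1 X2; rewrite /= -addnS addn1; exact.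
  + move=> x Hx; rewrite upd_other ?O1 //; lia.
  + by rewrite upd_same V1.
Qed.

(** * A program logic with running times *)

(* Only the registers below [tmp] are specified: evaluating expressions clobbers
   the others. *)
Definition tri W (c : cmd) (rg M : nat -> nat) (N : nat)
    (Q : (nat -> nat) -> (nat -> nat) -> Prop) : Prop :=
  forall P b R, frag P b (compile b c) -> agree R rg ->
  exists t R' rg' M', [/\ t <= N, Q rg' M', agree R' rg' &
    reaches P W b R M t (b + csize c) R' M'].

Lemma tri_conseq W c rg M N N' (Q Q' : _ -> _ -> Prop) :
  tri W c rg M N Q -> N <= N' -> (forall rg' M', Q rg' M' -> Q' rg' M') ->
  tri W c rg M N' Q'.
Proof.
move=> H HN HQ P b R F A; have [t [R' [rg' [M' [Ht q Ar X]]]]] := H P b R F A.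
exists t, R', rg', M'; split=> //; [exact: leq_trans HN | exact: HQ].
Qed.

Lemma tri_le W c rg M N N' Q : tri W c rg M N Q -> N <= N' -> tri W c rg M N' Q.
Proof. by move=> H HN; apply: tri_conseq HN _; first exact: H. Qed.

(** The postcondition of the first command is a triple for the second one, so a proof follows the
    run and needs no intermediate assertions. *)
Lemma tri_seq W c d rg M N1 N2 Q :
  tri W c rg M N1 (fun rg' M' => tri W d rg' M' N2 Q) ->
  tri W (c ;; d) rg M (N1 + N2) Q.
Proof.
move=> H P b R /= /frag_cat[F1]; rewrite size_compile => F2 A.
have [t1 [R1 [rg1 [M1 [Ht1 Q1 A1 X1]]]]] := H P b R F1 A.
have [t2 [R2 [rg2 [M2 [Ht2 Q2 A2 X2]]]]] := Q1 P _ R1 F2 A1.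
exists (t1 + t2), R2, rg2, M2; split=> //; first exact: leq_add.
by rewrite addnA; apply: reaches_trans X2.
Qed.

Lemma tri_asg W d e rg M Q :
  d < tmp -> ok W rg M e -> Q (upd rg d (eval rg M e)) M ->
  tri W (Asg d e) rg M (esize e + 2) Q.
Proof.
move=> Hd K q P b R /= /frag_cat[F1]; rewrite size_comp_expr.
move=> /frag_cons[F2 /frag_cons[F3 _]] A.
have [R1 [V1 O1 X1]] := comp_expr_correct F1 (leqnn _) A K.
have X2 := @reaches_step P W _ R1 M _ F2 isT.
have X3 := @reaches_step P W _ (upd R1 tmp.+1 (0 %% W)) M _ F3 isT.
do 4 eexists; split; [exact: leqnn|exact: q| |]; last first.
  by apply: reaches_cast (reaches_trans (reaches_trans X1 X2) X3) _ _ => /=; lia.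
move=> x Hx /=; case: (eqVneq x d) => [->|Hne].
  by rewrite !upd_same mod0n subn0 upd_other ?V1.
by rewrite !upd_other ?O1 ?A //; rewrite ltn_eqF // ltnS ltnW.
Qed.

Lemma tri_sto W a e rg M Q :
  ok W rg M a -> ok W rg M e -> Q rg (upd M (eval rg M a) (eval rg M e)) ->
  tri W (Sto a e) rg M (esize a + esize e + 1) Q.
Proof.
move=> Ka Ke q P b R /= /frag_cat[F1]; rewrite size_comp_expr.
move=> /frag_cat[F2]; rewrite size_comp_expr => /frag_cons[F3 _] A.
have [R1 [V1 O1 X1]] := comp_expr_correct F1 (leqnn _) A Ka.
have A1 : agree R1 rg by move=> x Hx; rewrite O1 ?A.
have [R2 [V2 O2 X2]] := comp_expr_correct F2 (leqnSn _) A1 Ke.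
have X3 := @reaches_step P W _ R2 M _ F3 isT.
do 4 eexists; split; [exact: leqnn|exact: q| |]; last first.
  rewrite /= O2 // V1 V2 in X3.
  by apply: reaches_cast (reaches_trans (reaches_trans X1 X2) X3) _ _; lia.
by move=> x Hx; rewrite O2 ?A1 // ltnS ltnW.
Qed.

(** A failed test pays for the test alone. This is what makes equal coordinates cheap when a row is
    corrected. *)
Lemma tri_when W e c rg M N Q :
  ok W rg M e -> (eval rg M e <> 0 -> tri W c rg M N Q) ->
  (eval rg M e = 0 -> Q rg M) ->
  tri W (When e c) rg M (esize e + 1 + (eval rg M e != 0) * N) Q.
Proof.
move=> K H1 H0 P b R /= /frag_cat[F1]; rewrite size_comp_expr.
move=> /frag_cons[F2 F3] A.
have [R1 [V1 O1 X1]] := comp_expr_correct F1 (leqnn _) A K.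
have A1 : agree R1 rg by move=> x Hx; rewrite O1 ?A.
have X2 := @reaches_step P W _ R1 M _ F2 isT.
have := reaches_trans X1 X2; rewrite /= V1.
case: eqP => E X.
  exists (esize e + 1), R1, rg, M; split=> //; [by rewrite addn0|exact: H0].
have F3' : frag P (b + esize e + 1) (compile (b + esize e + 1) c) by rewrite {1}addn1.
have [t [R2 [rg2 [M2 [Ht q A2 X3]]]]] := H1 E P _ R1 F3' A1.
exists (esize e + 1 + t), R2, rg2, M2; split=> //.
  by rewrite mul1n leq_add2l.
apply: reaches_cast (reaches_trans (reaches_cast X erefl _) X3) _ _ => /=; lia.
Qed.

(** The number [n] of runs is fixed beforehand and the body has to tie the exit test to the index;
    termination is thus part of the rule. The bound [f i] may vary with the run. *)
Lemma tri_do W c e (J : nat -> (nat -> nat) -> (nat -> nat) -> Prop) f n rg M Q :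
  0 < n -> J 0 rg M ->
  (forall i rg' M', i < n -> J i rg' M' -> tri W c rg' M' (f i)
     (fun rg2 M2 => [/\ ok W rg2 M2 e, (eval rg2 M2 e == 0) = (i.+1 < n) &
        if i.+1 < n then J i.+1 rg2 M2 else Q rg2 M2])) ->
  tri W (Do c e) rg M (\sum_(i < n) (f i + (esize e + 1))) Q.
Proof.
move=> n0 J0 HJ P b R F A.
have [Fc] := frag_cat F; rewrite size_compile => /frag_cat[Fe].
rewrite size_comp_expr => /frag_cons[Fj _].
suff main d i rg0 M0 R0 : n = i + d.+1 -> J i rg0 M0 -> agree R0 rg0 ->
    exists t R' rg' M', [/\ t <= \sum_(i <= j < n) (f j + (esize e + 1)), Q rg' M',
      agree R' rg' & reaches P W b R0 M0 t (b + csize (Do c e)) R' M'].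
  have := @main n.-1 0 rg M R; rewrite big_mkord add0n prednK //.
  by move/(_ erefl J0 A).
elim: d i rg0 M0 R0 => [|d IHd] i rg0 M0 R0 En Ji A0.
all: have Hi : i < n by rewrite En addnS ltnS leq_addr.
all: have [t1 [R1 [rg1 [M1 [Ht1 [K E HQ] A1 X1]]]]] := HJ _ _ _ Hi Ji P b R0 Fc A0.
all: have [R2 [V2 O2 X2]] := comp_expr_correct Fe (leqnn _) A1 K.
all: have X3 := @reaches_step P W _ R2 M1 _ Fj isT.
all: have := reaches_trans (reaches_trans X1 X2) X3; rewrite /= V2 E.
all: have A2 : agree R2 rg1 by move=> x Hx; rewrite O2 ?A1.
- have Hi1 : (i.+1 < n) = false by lia.
  rewrite Hi1 in HQ * => X.
  exists (t1 + esize e + 1), R2, rg1, M1; split=> //.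
    rewrite big_ltn // big_geq; lia.
  by apply: reaches_cast X _ _ => /=; lia.
- have Hi1 : i.+1 < n by lia.
  rewrite Hi1 in HQ * => X.
  have [|t [R3 [rg3 [M3 [Ht q A3 X']]]]] := IHd i.+1 rg1 M1 R2 _ HQ A2; first lia.
  exists (t1 + esize e + 1 + t), R3, rg3, M3; split=> //.
    rewrite big_ltn //; lia.
  exact: reaches_trans X'.
Qed.

(** The body runs at least once, hence the hypothesis [0 < n] of the rule below. By truncation
    [$v + #1 - $b] is nonzero exactly when the incremented [v] has reached the bound. *)
Definition For (v b : nat) (c : cmd) : cmd :=
  Asg v #0 ;; Do (c ;; Asg v ($v + #1)) ($v + #1 - $b)%E.

(* [l] separates the registers preserved by the loop from its own. *)
Lemma tri_for W v b c l (J : nat -> (nat -> nat) -> (nat -> nat) -> Prop) f n N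
    rg M Q :
  b < l -> l <= v -> v < tmp -> rg b = n -> 0 < n -> n.+1 < W ->
  J 0 (upd rg v 0) M ->
  (forall i rg' M', i < n -> rg' v = i -> (forall x, x < l -> rg' x = rg x) ->
     J i rg' M' -> tri W c rg' M' (f i)
     (fun rg2 M2 => [/\ rg2 v = i, forall x, x < l -> rg2 x = rg x &
        J i.+1 (upd rg2 v i.+1) M2])) ->
  (forall rg' M', (forall x, x < l -> rg' x = rg x) -> J n rg' M' -> Q rg' M') ->
  \sum_(i < n) (f i + 14) + 3 <= N ->
  tri W (For v b c) rg M N Q.
Proof.
move=> Hb Hl Hv En n0 HW J0 HJ HQ HN.
(* The constants of the bound: 3 steps for the initialisation, and per iteration 6 for the increment
   and 8 for the test with its jump. *)
rewrite /For; eapply tri_le.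
  apply: tri_seq; apply: tri_asg => //=; first by lia.
  apply: (@tri_do _ _ _ (fun i rg' M' => [/\ rg' v = i,
     forall x, x < l -> rg' x = rg x & J i rg' M']) (fun i => f i + 6) n) => //.
    split=> //; first by rewrite upd_same.
    by move=> x Hx; rewrite upd_other //; lia.
  move=> i rg1 M1 Hi [Ei Hx Ji].
  apply: (@tri_seq _ _ _ _ _ _ 6).
  apply: tri_conseq (leqnn _) _; first exact: HJ.
  move=> rg2 M2 [E2 O2 J2]; apply: tri_asg => //=; first by split=> //; lia.
  rewrite upd_same !E2 !addn1 upd_other; last by lia.
  rewrite O2 // En.
  have O3 x : x < l -> upd rg2 v i.+1 x = rg x by move=> Hxl; rewrite upd_other ?O2 //; lia.
  split.
  - split; last exact: leq_trans Hb (leq_trans Hl (ltnW Hv)).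
    by split=> //; lia.
  - lia.
  - case: ltnP => Hn; first by split=> //; rewrite upd_same.
    by apply: HQ => //; have -> : n = i.+1 by lia.
rewrite -[_ + 3]addnC in HN; apply: leq_trans HN; rewrite leq_add2l.
by apply: leq_sum => i _ /=; lia.
Qed.

(** * Farthest-first traversal *)

(* Parameters live below register 30, work registers from there on, and an inner
   loop only uses registers numbered above those that it has to preserve. *)
Notation vp := 0 (only parsing).
Notation vq := 1 (only parsing).
Notation vr := 2 (only parsing).
Notation vl := 3 (only parsing).
Notation vk := 4 (only parsing).
Notation vn := 5 (only parsing).
Notation vm := 6 (only parsing).
Notation vL := 7 (only parsing).
Notation vBX := 8 (only parsing).
Notation vSX := 9 (only parsing).
Notation vTX := 10 (only parsing).
Notation vBY := 11 (only parsing).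
Notation vSY := 12 (only parsing).
Notation vTY := 13 (only parsing).
Notation vO := 14 (only parsing).
Notation vOX := 15 (only parsing).
Notation vOY := 16 (only parsing).
Notation vE := 17 (only parsing).

Notation gc := 30 (only parsing).
Notation gcnt := 31 (only parsing).
Notation gbest := 32 (only parsing).
Notation gfar := 33 (only parsing).
Notation gi := 34 (only parsing).
Notation gcl := 35 (only parsing).
Notation gh := 36 (only parsing).
Notation gx := 37 (only parsing).
Notation gy := 38 (only parsing).

(** Base and both strides are kept in registers, so that the same code reads the rows of one matrix
    or the columns of the other. *)
Definition ldX i h : expr := ELd ($vBX + $i * $vSX + $h * $vTX).
Definition ldY j h : expr := ELd ($vBY + $j * $vSY + $h * $vTY).

Definition hamn (q : nat) (u v : nat -> bool) : nat := \sum_(h < q) (u h != v h).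

Lemma sum_ord_le q (F : 'I_q -> nat) : (forall h, F h <= 1) -> \sum_(h < q) F h <= q.
Proof.
move=> HF; apply: (@leq_trans (\sum_(h < q) 1)); first exact: leq_sum.
by rewrite sum1_card card_ord.
Qed.

Lemma hamn_le q u v : hamn q u v <= q.
Proof. by apply: sum_ord_le => h; exact: leq_b1. Qed.

Lemma hamnC q u v : hamn q u v = hamn q v u.
Proof. by apply: eq_bigr => i _; rewrite eq_sym. Qed.

(** With truncated subtraction, [(x - y) + (y - x)] is the absolute difference. Counting down from
    [q + 1] leaves at least 1, which is distinct from the 0 of an untouched cell. *)
Definition closeness : cmd :=
  Asg gcl ($vq + #1) ;;
  For gh vq (
    Asg gx (ldX gi gh) ;;
    Asg gy (ldX gc gh) ;;
    Asg gcl ($gcl - (($gx - $gy) + ($gy - $gx)))).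

(** Gonzalez's greedy algorithm for the k-center problem, started from row 0. Three tables of length
    [n] follow [vE]: closeness to the chosen rows, nearest chosen row, list of chosen rows. A single
    pass updates the first two against the newest row and finds the next one, so a round costs $nq$.
    The value [q + 2] exceeds every closeness, hence the first row scanned always replaces it. *)
Definition gonz : cmd :=
  Asg gc #0 ;; Asg gbest #0 ;;
  For gcnt vL (
    Sto ($vE + $vn + $vn + $gcnt) $gc ;;
    Asg gbest ($vq + #2) ;; Asg gfar #0 ;;
    For gi vn (
      closeness ;;
      When ($gcl - ELd ($vE + $gi))
        (Sto ($vE + $gi) $gcl ;; Sto ($vE + $vn + $gi) $gc) ;;
      When ($gbest - ELd ($vE + $gi))
        (Asg gbest (ELd ($vE + $gi)) ;; Asg gfar $gi)) ;;
    Asg gc $gfar).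

Definition holds (M : nat -> nat) n q b s t (X : nat -> nat -> bool) : Prop :=
  forall i h, i < n -> h < q -> M (b + i * s + h * t) = X i h.

Ltac crush := rewrite /upd /=; repeat split; try lia.
Ltac frame O := let x := fresh "x" in let Hx := fresh "Hx" in
  move=> x Hx; rewrite /upd; repeat (case: eqP => [?|_]; first lia);
  try (rewrite O; [rewrite /upd; repeat (case: eqP => [?|_]; first lia)|lia]);
  done.

Lemma closeness_correct W n q b s t X rg M :
  holds M n q b s t X ->
  (forall i h, i < n -> h < q -> b + i * s + h * t < W) -> 
  rg vq = q -> rg vBX = b -> rg vSX = s -> rg vTX = t ->
  rg gi < n -> rg gc < n -> 0 < q -> q.+1 < W ->
  tri W closeness rg M (100 * q) (fun rg' M' =>
   [/\ forall x, x < 35 -> rg' x = rg x,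
      rg' gcl = q.+1 - hamn q (X (rg gi)) (X (rg gc)) & M' = M]).
Proof.
move=> HX HW Eq Eb Es Et Hi Hc q0 Wq; rewrite /closeness; eapply tri_le.
  apply: tri_seq; apply: tri_asg => //; first by crush.
  apply: (@tri_for _ _ _ _ 35 (fun h rg' M' =>
    rg' gcl = q.+1 - hamn h (X (rg gi)) (X (rg gc)) /\ M' = M) (fun _ => 60) q) => //.
  - split => //; rewrite /upd /= /hamn big_ord0; lia.
  - move=> h rg1 M1 Hh Eh O [Ee ->].
    have PE : (rg1 vq = q) * (rg1 vBX = b) * (rg1 vSX = s) * (rg1 vTX = t) *
      (rg1 gi = rg gi) * (rg1 gc = rg gc).
      by rewrite !O //.
    have Ai := HW _ _ Hi Hh; have Ac := HW _ _ Hc Hh.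
    eapply tri_le.
      apply: tri_seq; apply: tri_asg => //=; first by rewrite !PE Eh; crush.
      apply: tri_seq; apply: tri_asg => //=; first by rewrite /upd /= !PE Eh; crush.
      rewrite /upd /= !PE Eh !HX //.
      apply: tri_asg => //=; first by rewrite /upd /=; crush.
      crush; first by frame O.
      rewrite Ee /hamn big_ord_recr /=; case: (X _ _); case: (X _ _) => /=; lia.
    by rewrite /=; lia.
  - by move=> rg1 M1 O [Ee EM]; split=> // x Hx; rewrite O // upd_other //; lia.
by rewrite sum_nat_const card_ord /=; lia.
Qed.

(* [E i] is [q + 1] minus the distance from row [i] to the chosen rows [cs]
   ([0] when [cs] is empty), [As i] a nearest chosen row, and [c] a row with the
   least value [best] of [E], the next one to be chosen. *)
Record traversal q n (X : nat -> nat -> bool) (cs : seq nat) (E As : nat -> nat)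
    (c best : nat) : Prop := Traversal {
  trv_assigned : forall i, i < n ->
    E i = 0 \/ As i \in cs /\ hamn q (X i) (X (As i)) + E i = q.+1;
  trv_nearest : forall i a, i < n -> a \in cs -> q.+1 <= E i + hamn q (X i) (X a);
  trv_best : forall i, i < n -> best <= E i;
  trv_next : E c = best;
  trv_rows : forall a, a \in rcons cs c -> a < n;
  trv_spread : pairwise (fun a b => q.+1 <= best + hamn q (X a) (X b)) (rcons cs c)
}.

Lemma traversal_le q n X cs E As c best i :
  traversal q n X cs E As c best -> i < n -> E i <= q.+1.
Proof. by move=> G Hi; case: (trv_assigned G Hi) => [->//|[_]]; lia. Qed.

(** Closeness only grows, so [best <= best'] and the old pairs remain spread for the weaker
    threshold. The new row [c'] attains [best'], so its distance to each chosen row is at least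
    [q.+1 - best']. *)
Lemma traversal_next q n X cs E As c best E' As' c' best' :
  traversal q n X cs E As c best ->
  (forall i, i < n -> E' i = maxn (E i) (q.+1 - hamn q (X i) (X c))) ->
  (forall i, i < n ->
     As' i = if E i < q.+1 - hamn q (X i) (X c) then c else As i) ->
  (forall i, i < n -> best' <= E' i) -> c' < n -> E' c' = best' ->
  traversal q n X (rcons cs c) E' As' c' best'.
Proof.
move=> G HE HA Hb Hc' Ec'.
have Hc : c < n by apply: (trv_rows G); rewrite mem_rcons mem_head.
have near i a : i < n -> a \in rcons cs c -> q.+1 <= E' i + hamn q (X i) (X a).
  move=> Hi; rewrite HE // mem_rcons inE => /orP[/eqP->|Ha]; first by lia.
  by have := trv_nearest G Hi Ha; lia.
split=> //.
- move=> i Hi; rewrite HE // HA //; case: ltnP => Hlt.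
    right; rewrite mem_rcons mem_head; split=> //.
    have := hamn_le q (X i) (X c); lia.
  by case: (trv_assigned G Hi) => [E0|[Ha Hs]]; [left|right];
    rewrite ?mem_rcons ?inE ?Ha ?orbT; try split; lia.
- by move=> a; rewrite mem_rcons inE => /orP[/eqP->//|]; apply: (trv_rows G).
- rewrite pairwise_rcons; apply/andP; split.
    apply/allP => a Ha; rewrite hamnC -Ec'.
    by apply: near.
  apply: sub_pairwise (trv_spread G) => a b /=.
  have : best <= best'; last by lia.
  have := trv_best G Hc'; have := HE _ Hc'; lia.
Qed.

Lemma traversal_step_correct W n q b s t bE X rg M :
  holds M n q b s t X ->
  (forall i h, i < n -> h < q -> b + i * s + h * t < bE) -> 
  bE + 3 * n < W -> q.+2 < W ->
  rg vq = q -> rg vn = n -> rg vBX = b -> rg vSX = s -> rg vTX = t -> rg vE = bE ->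
  rg gc < n -> 0 < q -> 0 < n -> rg gbest = q.+2 ->
  (forall i, i < n -> M (bE + i) <= q.+1) ->
  tri W (For gi vn (
      closeness ;;
      When ($gcl - ELd ($vE + $gi))
        (Sto ($vE + $gi) $gcl ;; Sto ($vE + $vn + $gi) $gc) ;;
      When ($gbest - ELd ($vE + $gi))
        (Asg gbest (ELd ($vE + $gi)) ;; Asg gfar $gi))) rg M (200 * n * q)
  (fun rg' M' => let cl i := q.+1 - hamn q (X i) (X (rg gc)) in
   [/\ forall x, x < 32 -> rg' x = rg x,
      forall a, ~~ (bE <= a < bE + n + n) -> M' a = M a,
      (forall i, i < n -> M' (bE + i) = maxn (M (bE + i)) (cl i)) /\
      (forall i, i < n ->
        M' (bE + n + i) = if M (bE + i) < cl i then rg gc else M (bE + n + i)),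
      forall i, i < n -> rg' gbest <= M' (bE + i) &
      rg' gfar < n /\ M' (bE + rg' gfar) = rg' gbest]).
Proof.
move=> HX HA HW Wq Eq En Eb Es Et EE Hc q0 n0 Ebest HM.
set cl := fun i => q.+1 - hamn q (X i) (X (rg gc)).
apply: (@tri_for _ _ _ _ 32 (fun i rg' M' =>
  [/\ forall a, ~~ (bE <= a < bE + n + n) -> M' a = M a,
      (forall j, j < n ->
         M' (bE + j) = if j < i then maxn (M (bE + j)) (cl j) else M (bE + j)) /\
      (forall j, j < n ->
        M' (bE + n + j) = if (j < i) && (M (bE + j) < cl j) then rg gc
                          else M (bE + n + j)),
      forall j, j < i -> rg' gbest <= M' (bE + j) &
      i = 0 /\ rg' gbest = q.+2 \/
      rg' gfar < i /\ M' (bE + rg' gfar) = rg' gbest])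
  (fun _ => 100 * q + 60) n) => //.
- lia.
- by split=> //; left.
- move=> i rg1 M1 Hi Ei O [HO [HE HAs] Hmin Hbest].
  have PE : (rg1 vq = q) * (rg1 vn = n) * (rg1 vBX = b) * (rg1 vSX = s) *
      (rg1 vTX = t) * (rg1 vE = bE) * (rg1 gc = rg gc) by rewrite !O //.
  eapply tri_le.
    apply: tri_seq; apply: tri_conseq (leqnn _) _.
      apply: (@closeness_correct _ n q b s t X); rewrite ?PE ?Ei //.
      + by move=> j h Hj Hh; rewrite HO ?HX //; have := HA _ _ Hj Hh; lia.
      + by move=> j h Hj Hh; have := HA _ _ Hj Hh; lia.
      + lia.
    move=> rg2 M2 [O2 Ee ->]; rewrite Ei PE -/(cl i) in Ee.
    have PE2 : (rg2 vq = q) * (rg2 vn = n) * (rg2 vE = bE) * (rg2 gc = rg gc) *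
      (rg2 gbest = rg1 gbest) * (rg2 gfar = rg1 gfar) * (rg2 gi = i)
      by rewrite !O2 // !PE Ei.
    pose M3 := if M1 (bE + i) < cl i
      then upd (upd M1 (bE + i) (cl i)) (bE + n + i) (rg gc) else M1.
    apply: tri_seq.
    apply: (@tri_conseq _ _ _ _ _ _ (fun rg' M' => rg' = rg2 /\ M' = M3)).
    + apply: tri_when.
      * by rewrite /= !PE2; crush.
      * move=> /= H; rewrite /M3 (_ : _ < _); last by rewrite !PE2 Ee in H; lia.
        apply: tri_seq; apply: tri_sto => //=; first by rewrite !PE2; crush.
        by apply: tri_sto => //=; rewrite ?PE2 ?Ee //; crush.
      * move=> /= H; rewrite /M3 (_ : _ < _ = false) //; rewrite !PE2 Ee in H; lia.
    + by apply: leq_add (leqnn _) (leq_mul (leq_b1 _) (leqnn _)).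
    have HE3 j : j < n ->
       M3 (bE + j) = if j < i.+1 then maxn (M (bE + j)) (cl j) else M (bE + j).
      move=> Hj; rewrite /M3; have := HE _ Hj; have := HE _ Hi; rewrite ltnn => Ei0 Ej.
      rewrite Ei0; case: ltnP => Hlt.
        rewrite upd_other; last by lia.
        case: (eqVneq j i) => [->|Nij]; first by rewrite upd_same ltnSn; lia.
        rewrite upd_other ?Ej; last by lia.
        by have -> : (j < i.+1) = (j < i) by lia.
      rewrite Ej; case: (eqVneq j i) => [->|Nij]; first by rewrite ltnn ltnSn; lia.
      by have -> : (j < i.+1) = (j < i) by lia.
    have HA3 j : j < n ->
       M3 (bE + n + j) = if (j < i.+1) && (M (bE + j) < cl j) then rg gc
                          else M (bE + n + j).
      move=> Hj; rewrite /M3; have := HAs _ Hj; have := HE _ Hi; rewrite ltnn => Ei0 Ej.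
      rewrite Ei0; case: ltnP => Hlt.
        case: (eqVneq j i) => [->|Nij]; first by rewrite upd_same ltnSn Hlt.
        rewrite !upd_other ?Ej; try lia.
        by have -> : (j < i.+1) = (j < i) by lia.
      rewrite Ej; case: (eqVneq j i) => [->|Nij]; first by rewrite ltnn ltnSn /= ltnNge Hlt.
      by have -> : (j < i.+1) = (j < i) by lia.
    have HO3 a : ~~ (bE <= a < bE + n + n) -> M3 a = M a.
      by move=> Ha; rewrite /M3; case: ifP => _; rewrite ?upd_other ?HO //; lia.
    have mono j : j < n -> M1 (bE + j) <= M3 (bE + j).
      move=> Hj; rewrite HE // HE3 //.
      by case: (ltnP j i) => Hji; case: ifP; lia.
    have Hkeep j : j < i -> M3 (bE + j) = M1 (bE + j).
      by move=> Hj; rewrite HE ?HE3 ?Hj ?(ltnW Hj) // ?(ltn_trans Hj) // leqW.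
    have Hi3 : M3 (bE + i) <= q.+1.
      by rewrite HE3 // ltnSn; have := HM _ Hi; rewrite /cl; lia.
    move=> _ _ [-> ->]; apply: tri_conseq.
    + apply: (@tri_when _ _ _ _ _ _ (fun rg' M' => [/\ M' = M3,
         forall x, x < 32 -> rg' x = rg x, rg' gi = i,
         forall j, j < i.+1 -> rg' gbest <= M3 (bE + j) &
         rg' gfar < i.+1 /\ M3 (bE + rg' gfar) = rg' gbest])).
      * by rewrite /= !PE2; crush.
      * rewrite /= !PE2 => H.
        apply: tri_seq; apply: tri_asg => //=; first by rewrite !PE2; crush.
        apply: tri_asg => //=; split=> //; last 1 first.
        -- by rewrite /upd /= !PE2.
        -- move=> x Hx; rewrite !upd_other ?O2 ?O //; lia.
        -- by rewrite /upd /= !PE2.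
        -- move=> j Hj; rewrite /upd /= !PE2; case: (eqVneq j i) => [->//|Nij].
           by have := Hmin j; rewrite (Hkeep j); lia.
      * rewrite /= !PE2 => H; split=> //.
        -- by move=> x Hx; rewrite O2 ?O //; lia.
        -- move=> j Hj; case: (eqVneq j i) => [->|Nij]; first by lia.
           by rewrite (Hkeep j); [apply: Hmin|]; lia.
        (* Before any row has been scanned, [gbest] is [q.+2] and exceeds the closeness of row [i],
           so the test could not have failed. *)
        -- case: Hbest => [[E0 Eb0]|[Hf Ef]]; first by exfalso; lia.
           by rewrite (Hkeep _ Hf) ?PE2; split=> //; apply: leqW.
    + by apply: leq_add (leqnn _) (leq_mul (leq_b1 _) (leqnn _)).
    move=> rg4 M4 [-> O4 E4 Hmin4 Hbest4]; split=> //.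
    by split=> //; right.
  by rewrite /=; lia.
- move=> rg1 M1 O [HO [HE HAs] Hmin Hbest]; split=> //.
  + by split=> j Hj; rewrite ?HE ?HAs Hj.
  + by case: Hbest => [[En0]|//]; lia.
by rewrite sum_nat_const card_ord; nia.
Qed.

Lemma gonz_correct W n L q b s t bE X rg M :
  holds M n q b s t X ->
  (forall i h, i < n -> h < q -> b + i * s + h * t < bE) ->
  bE + 3 * n < W -> q.+2 < W ->
  rg vq = q -> rg vn = n -> rg vL = L -> rg vBX = b -> rg vSX = s -> rg vTX = t ->
  rg vE = bE -> 0 < q -> 0 < L <= n ->
  (forall i, i < n -> M (bE + i) = 0) ->
  tri W gonz rg M (400 * L * n * q) (fun rg' M' =>
   exists cs c, [/\ size cs = L, forall x, x < 30 -> rg' x = rg x,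
     forall a, ~~ (bE <= a < bE + 3 * n) -> M' a = M a,
     forall u, u < L -> M' (bE + n + n + u) = nth 0 cs u &
     traversal q n X cs (fun i => M' (bE + i)) (fun i => M' (bE + n + i)) c
       (rg' gbest)]).
Proof.
move=> HX HA HW Wq Eq En EL Eb Es Et EE q0 /andP[L0 HL] HM; rewrite /gonz.
have n0 : 0 < n by lia.
eapply tri_le.
  apply: tri_seq; apply: tri_asg => //; first by crush.
  apply: tri_seq; apply: tri_asg => //; first by crush.
  apply: (@tri_for _ _ _ _ 30 (fun u rg' M' => rg' gc < n /\
    exists cs, [/\ size cs = u,
     forall a, ~~ (bE <= a < bE + 3 * n) -> M' a = M a,
     forall u', u' < u -> M' (bE + n + n + u') = nth 0 cs u' &
     traversal q n X cs (fun i => M' (bE + i)) (fun i => M' (bE + n + i)) (rg' gc)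
       (rg' gbest)]) (fun u => 200 * n * q + 40) L) => //.
  - lia.
  - split=> //; exists [::]; split=> //; rewrite /upd /=; split=> //.
    + by move=> i Hi; rewrite HM //; left.
    + by rewrite HM.
    + by move=> a; rewrite inE => /eqP ->.
  - move=> u rg1 M1 Hu Eu O [Hc [cs [Hs HO Hcs HT]]].
    have PE : (rg1 vq = q) * (rg1 vn = n) * (rg1 vL = L) * (rg1 vBX = b) *
      (rg1 vSX = s) * (rg1 vTX = t) * (rg1 vE = bE) by rewrite !O.
    eapply tri_le.
      apply: tri_seq; apply: tri_sto => //=; first by rewrite !PE Eu; crush.
      apply: tri_seq; apply: tri_asg => //=; first by rewrite !PE; crush.
      apply: tri_seq; apply: tri_asg => //=; first by crush.
      rewrite /= !PE Eu; set M2 := upd M1 _ _.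
      have HM2 a : a < bE + n + n -> M2 a = M1 a.
        by move=> Ha; rewrite /M2 upd_other //; lia.
      apply: tri_seq; apply: tri_conseq (leqnn _) _.
        apply: (@traversal_step_correct _ n q b s t bE X); rewrite /upd /= ?PE //.
        + move=> i h Hi Hh; have Ha := HA _ _ Hi Hh.
          by rewrite HM2 ?HO ?HX //; lia.
        + lia.
        + by move=> i Hi; rewrite HM2 ?(traversal_le HT Hi) //; lia.
      move=> rg3 M3 [O3 HM3 [HE3 HA3] Hmin [Hfar Ebest]].
      rewrite /upd /= in O3 HE3 HA3.
      apply: tri_asg => //=; split=> //.
      + by rewrite upd_other // O3.
      + move=> x Hx; rewrite -O // upd_other ?O3; try lia.
        by repeat (case: eqP => [?|_]; first lia).
      split; first by rewrite /upd /=.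
      exists (rcons cs (rg1 gc)); split.
      + by rewrite size_rcons Hs.
      + by move=> a Ha; rewrite HM3 /M2 ?upd_other ?HO //; lia.
      + move=> u' Hu'; rewrite nth_rcons Hs HM3; last by lia.
        case: (ltnP u' u) => Huu; first by rewrite /M2 upd_other ?Hcs //; lia.
        by rewrite (_ : u' = u) ?eqxx /M2 ?upd_same //; lia.
      + rewrite /upd /=; apply: (traversal_next HT) => //.
        * by move=> i Hi; rewrite HE3 // HM2 //; lia.
        * by move=> i Hi; rewrite HA3 // !HM2 //; lia.
    by rewrite /=; lia.
  - move=> rg1 M1 O [Hc [cs [Hs HO Hcs HT]]]; exists cs, (rg1 gc); split=> //.
    by frame O.
rewrite sum_nat_const card_ord /=.
have : 0 < n * q by rewrite muln_gt0 n0.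
nia.
Qed.

(** * Products from a set of representatives *)

Notation fi := 30 (only parsing).
Notation fc := 31 (only parsing).
Notation fj := 32 (only parsing).
Notation facc := 33 (only parsing).
Notation fk := 34 (only parsing).
Notation fh := 32 (only parsing).
Notation fx := 33 (only parsing).
Notation fy := 34 (only parsing).
Notation fj' := 36 (only parsing).

Definition out i j : expr := ($vO + $i * $vOX + $j * $vOY)%E.

Definition dot : cmd :=
  Asg facc #0 ;;
  For fk vq (Asg facc ($facc + ldX fc fk * ldY fj fk)).

Definition seed_rows : cmd :=
  For fi vL (
    Asg fc (ELd ($vE + $vn + $vn + $fi)) ;;
    For fj vm (dot ;; Sto (out fc fj) $facc)).

Definition correct_row : cmd :=
  For fh vq (
    Asg fx (ldX fi fh) ;;
    Asg fy (ldX fc fh) ;;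
    When (($fx - $fy) + ($fy - $fx))
      (For fj' vm (Sto (out fi fj')
         (ELd (out fi fj') + $fx * ldY fj' fh - $fy * ldY fj' fh)))).

Definition derive_rows : cmd :=
  For fi vn (
    Asg fc (ELd ($vE + $vn + $fi)) ;;
    For fj vm (Sto (out fi fj) (ELd (out fc fj))) ;;
    correct_row).

Definition dotn (q : nat) (u v : nat -> bool) : nat := \sum_(h < q) (u h * v h).

(** The value of an entry midway through [correct_row]: the coordinates below [h] are already those
    of the row [u] wanted, the others still those of the neighbour [u'] whose entry was copied. *)
Definition mixn (q h : nat) (u u' v : nat -> bool) : nat :=
  \sum_(h' < q) ((if h' < h then u h' else u' h') * v h').

Lemma dotn_le q u v : dotn q u v <= q.
Proof. by apply: sum_ord_le => h; case: (u h); case: (v h). Qed.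

Lemma mixn_le q h u u' v : mixn q h u u' v <= q.
Proof. by apply: sum_ord_le => h'; case: ifP => _; case: (u h'); case: (u' h'); case: (v h'). Qed.

Lemma mixnn q u u' v : mixn q q u u' v = dotn q u v.
Proof. by apply: eq_bigr => h _; rewrite ltn_ord. Qed.

(** Having sums on both sides shows that the truncated subtraction in [correct_row] is exact. *)
Lemma mixnS q h u u' v : h < q ->
  mixn q h.+1 u u' v + u' h * v h = mixn q h u u' v + u h * v h.
Proof.
move=> Hh; rewrite /mixn (bigD1 (Ordinal Hh)) //= [in RHS](bigD1 (Ordinal Hh)) //=.
rewrite ltnSn ltnn addnAC [in RHS]addnAC [u h * v h + _]addnC; congr (_ + _).
apply: eq_bigr => h' Nh; rewrite ltnS leq_eqVlt.
by rewrite -(inj_eq val_inj) /= in Nh; rewrite (negbTE Nh).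
Qed.

(** Common to the three loops that write a row of the product: computing, copying and correcting it.
    The body may assume that only the cells of earlier indices have changed; injectivity of [adr]
    keeps those cells intact afterwards. *)
Lemma row_loop_correct W vj l body (adr F : nat -> nat) m K rg M :
  vm < l -> l <= vj -> vj < tmp -> rg vm = m -> 0 < m -> m.+1 < W ->
  (forall j j', j < m -> j' < m -> adr j = adr j' -> j = j') ->
  (forall j rg' M', j < m -> rg' vj = j -> (forall x, x < l -> rg' x = rg x) ->
     (forall a, (forall j', j' < j -> a <> adr j') -> M' a = M a) ->
     tri W body rg' M' K (fun rg2 M2 =>
       [/\ rg2 vj = j, forall x, x < l -> rg2 x = rg x & M2 = upd M' (adr j) (F j)])) ->
  tri W (For vj vm body) rg M ((K + 17) * m) (fun rg' M' =>
    [/\ forall x, x < l -> rg' x = rg x, forall j, j < m -> M' (adr j) = F j &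
      forall a, (forall j, j < m -> a <> adr j) -> M' a = M a]).
Proof.
move=> Hm Hl Hv Em m0 Wm inj HB.
apply: (@tri_for _ _ _ _ l (fun j rg' M' =>
  (forall j', j' < j -> M' (adr j') = F j') /\
  (forall a, (forall j', j' < j -> a <> adr j') -> M' a = M a)) (fun _ => K) m) => //.
- move=> j rg' M' Hj Ej O [HF HO].
  apply: tri_conseq (HB j rg' M' Hj Ej O HO) (leqnn _) _.
  move=> rg2 M2 [E2 O2 ->]; split=> //; split.
    move=> j' Hj'; case: (eqVneq j' j) => [->|Nj]; first by rewrite upd_same.
    rewrite upd_other ?HF //; first by lia.
    by apply/eqP => /inj Ejj; rewrite Ejj ?eqxx // in Nj; lia.
  move=> a Ha; rewrite upd_other ?HO //; last by apply/eqP; apply: Ha.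
  by move=> j' Hj'; apply: Ha; lia.
- by move=> rg' M' O [HF HO]; split.
by rewrite sum_nat_const card_ord; nia.
Qed.

Lemma dot_correct W n m q b s t b' s' t' X Y rg M :
  holds M n q b s t X -> holds M m q b' s' t' Y ->
  (forall i h, i < n -> h < q -> b + i * s + h * t < W) ->
  (forall j h, j < m -> h < q -> b' + j * s' + h * t' < W) ->
  rg vq = q -> rg vBX = b -> rg vSX = s -> rg vTX = t ->
  rg vBY = b' -> rg vSY = s' -> rg vTY = t' ->
  rg fc < n -> rg fj < m -> 0 < q -> q.+2 < W ->
  tri W dot rg M (100 * q) (fun rg' M' =>
   [/\ forall x, x < 33 -> rg' x = rg x,
      rg' facc = dotn q (X (rg fc)) (Y (rg fj)) & M' = M]).
Proof.
move=> HX HY HWX HWY Eq Eb Es Et Eb' Es' Et' Hc Hj q0 Wq; rewrite /dot; eapply tri_le.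
  apply: tri_seq; apply: tri_asg => //; first by crush.
  apply: (@tri_for _ _ _ _ 33 (fun h rg' M' =>
    rg' facc = dotn h (X (rg fc)) (Y (rg fj)) /\ M' = M) (fun _ => 36) q) => //.
  - lia.
  - by rewrite /upd /= /dotn big_ord0.
  - move=> h rg1 M1 Hh Eh O [Ea ->].
    have PE : (rg1 vq = q) * (rg1 vBX = b) * (rg1 vSX = s) * (rg1 vTX = t) *
      (rg1 vBY = b') * (rg1 vSY = s') * (rg1 vTY = t') *
      (rg1 fj = rg fj) * (rg1 fc = rg fc).
      by rewrite !O //.
    have Ai := HWX _ _ Hc Hh; have Ac := HWY _ _ Hj Hh.
    have Ha := dotn_le h (X (rg fc)) (Y (rg fj)).
    apply: tri_asg => //=; rewrite !PE Eh HX // HY // Ea.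
      by crush; case: (X _ _); case: (Y _ _) => /=; lia.
    crush; first by frame O.
    by rewrite /dotn big_ord_recr.
  - by move=> rg1 M1 O [Ee EM]; split=> // x Hx; rewrite O // upd_other //; lia.
by rewrite sum_nat_const card_ord /=; lia.
Qed.

(** * Memory layout of a task, and its two phases *)

(* The rows [i < n] of one factor start at [bX + i * sX], with entries [tX] apart;
   likewise the [m] rows of the other one. Entry [(i, j)] of the result goes to
   [adr i j]; [bE] is the base of the scratch area left by [gonz]. *)
Record task := Task {
  tn : nat; tm : nat; tL : nat; tq : nat;
  bX : nat; sX : nat; tX : nat; bY : nat; sY : nat; tY : nat;
  bO : nat; sO : nat; tO : nat; bE : nat }.

Definition adr d i j := bO d + i * sO d + j * tO d.

Record task_ok W d : Prop := TaskOk {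
  task_q : 0 < tq d;
  task_L : 0 < tL d <= tn d;
  task_m : 0 < tm d;
  task_inX : forall i h, i < tn d -> h < tq d -> bX d + i * sX d + h * tX d < bO d;
  task_inY : forall j h, j < tm d -> h < tq d -> bY d + j * sY d + h * tY d < bO d;
  task_out : forall i j, i < tn d -> j < tm d -> adr d i j < bE d;
  task_inj : forall i i' j j', i < tn d -> i' < tn d -> j < tm d -> j' < tm d ->
    adr d i j = adr d i' j' -> i = i' /\ j = j';
  task_base : bO d <= bE d;
  task_word : bE d + 3 * tn d + tm d + tq d + 3 < W }.

Definition params d (rg : nat -> nat) : Prop :=
  [/\ rg vq = tq d, rg vn = tn d, rg vm = tm d, rg vL = tL d & rg vE = bE d] /\
  [/\ rg vBX = bX d, rg vSX = sX d & rg vTX = tX d] /\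
  [/\ rg vBY = bY d, rg vSY = sY d & rg vTY = tY d] /\
  [/\ rg vO = bO d, rg vOX = sO d & rg vOY = tO d].

Lemma params_frame d rg rg' :
  params d rg -> (forall x, x < 30 -> rg' x = rg x) -> params d rg'.
Proof. by move=> H O; rewrite /params !O. Qed.

Definition inputs d (M : nat -> nat) X Y : Prop :=
  holds M (tn d) (tq d) (bX d) (sX d) (tX d) X /\
  holds M (tm d) (tq d) (bY d) (sY d) (tY d) Y.

(** The inputs lie below [bO] and the tables of the traversal from [bE] on, so this one frame
    condition preserves both while the product is written. *)
Definition unwritten d (M' M : nat -> nat) : Prop :=
  forall a, ~~ (bO d <= a < bE d) -> M' a = M a.

Lemma inputs_unwritten W d M M' X Y : task_ok W d ->
  inputs d M X Y -> unwritten d M' M -> inputs d M' X Y.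
Proof.
move=> K [HX HY] H; split=> i h Hi Hh.
  by rewrite H ?HX //; have := task_inX K Hi Hh; lia.
by rewrite H ?HY //; have := task_inY K Hi Hh; lia.
Qed.

Definition row_done d M (X Y : nat -> nat -> bool) i : Prop :=
  forall j, j < tm d -> M (adr d i j) = dotn (tq d) (X i) (Y j).

Definition other_rows d (M' M : nat -> nat) i : Prop :=
  forall a, (forall j, j < tm d -> a <> adr d i j) -> M' a = M a.

Lemma other_rows_unwritten W d M' M i : task_ok W d -> i < tn d ->
  other_rows d M' M i -> unwritten d M' M.
Proof.
move=> K Hi H a Ha; apply: H => j Hj Ea; have := task_out K Hi Hj.
have : bO d <= adr d i j by rewrite /adr; lia.
by rewrite -Ea; lia.
Qed.

Lemma other_rows_done W d M' M X Y i i' : task_ok W d -> i < tn d -> i' < tn d -> i != i' ->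
  other_rows d M' M i -> row_done d M X Y i' -> row_done d M' X Y i'.
Proof.
move=> K Hi Hi' N H HD j Hj; rewrite H ?HD // => j' Hj' E.
by have [Eii _] := task_inj K Hi' Hi Hj Hj' E; rewrite Eii eqxx in N.
Qed.

Lemma params_eqs d rg : params d rg ->
  (rg vq = tq d) * (rg vn = tn d) * (rg vm = tm d) * (rg vL = tL d) * (rg vE = bE d) *
  (rg vBX = bX d) * (rg vSX = sX d) * (rg vTX = tX d) *
  (rg vBY = bY d) * (rg vSY = sY d) * (rg vTY = tY d) *
  (rg vO = bO d) * (rg vOX = sO d) * (rg vOY = tO d).
Proof. by case=> [[? ? ? ? ?] [[? ? ?] [[? ? ?] [? ? ?]]]]. Qed.

Lemma seed_rows_correct W d X Y (cs : seq nat) rg M :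
  task_ok W d -> params d rg -> inputs d M X Y ->
  size cs = tL d -> (forall a, a \in cs -> a < tn d) ->
  (forall u, u < tL d -> M (bE d + tn d + tn d + u) = nth 0 cs u) ->
  tri W seed_rows rg M (200 * (tL d * tm d * tq d)) (fun rg' M' =>
   [/\ forall x, x < 30 -> rg' x = rg x, unwritten d M' M &
     forall c, c \in cs -> row_done d M' X Y c]).
Proof.
move=> K HP HI Hs Hcs HM; have [q0 /andP[L0 HL] m0 KX KY Kout _ Kb KW] := K.
apply: (@tri_for _ _ _ _ 30 (fun u rg' M' =>
   unwritten d M' M /\ forall u', u' < u -> row_done d M' X Y (nth 0 cs u'))
   (fun u => 160 * (tm d * tq d)) (tL d)) => //.
- by case: HP => [[]].
- lia.
- move=> u rg1 M1 Hu Eu O [HO HD].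
  have HP1 := params_frame HP O; have PP1 := params_eqs HP1.
  have Hc : nth 0 cs u < tn d by apply: Hcs; rewrite mem_nth // Hs.
  eapply tri_le.
    apply: tri_seq; apply: tri_asg => //=; first by rewrite !PP1 Eu; crush.
    rewrite /= !PP1 Eu HO ?HM //; last by lia.
    set c := nth 0 cs u in Hc *.
    apply: tri_conseq.
    + apply: (@row_loop_correct _ _ 32 _ (adr d c) (fun j => dotn (tq d) (X c) (Y j))
        (tm d) (100 * tq d + 20)) => //.
      * by rewrite /upd /= PP1.
      * lia.
      * by move=> j j' Hj Hj' E; have [] := task_inj K Hc Hc Hj Hj' E.
      * move=> j rg2 M2 Hj Ej O2 HO2.
        have HP2 : params d rg2 by apply: params_frame HP1 _; frame O2.
        have U2 : unwritten d M2 M.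
          move=> a Ha; rewrite HO2 ?HO // => j' Hj' Ea.
          have := Kout c j' Hc (ltn_trans Hj' Hj); rewrite -Ea.
          have : bO d <= adr d c j' by rewrite /adr; lia.
          by rewrite -Ea; lia.
        have [HX HY] := inputs_unwritten K HI U2.
        have Ec : rg2 fc = c by rewrite O2 ?upd_same.
        have PP2 := params_eqs HP2.
        eapply tri_le.
          apply: tri_seq; apply: tri_conseq (leqnn _) _.
            apply: (dot_correct HX HY) => //; rewrite ?PP2 ?Ec ?Ej //.
            - by move=> i h Hi Hh; have := KX _ _ Hi Hh; lia.
            - by move=> i h Hi Hh; have := KY _ _ Hi Hh; lia.
            - lia.
          move=> rg3 M3 [O3 Ea ->].
          have HP3 : params d rg3 by apply: params_frame HP2 _; frame O3.
          have PP3 := params_eqs HP3.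
          have Ec3 : rg3 fc = c by rewrite O3.
          have Ej3 : rg3 fj = j by rewrite O3.
          have := Kout c j Hc Hj; rewrite /adr => Hout.
          apply: tri_sto => //=; rewrite ?PP3 ?Ec3 ?Ej3; first by crush.
          split=> //; first by move=> x Hx; rewrite O3 ?O2 //; lia.
          by rewrite /adr Ea Ec Ej.
        by rewrite /=; lia.
    + exact: leqnn.
    move=> rg2 M2 [O2 HF HO2]; split; first by rewrite O2.
      by move=> x Hx; rewrite O2 ?upd_other ?O //; lia.
    have U2 := @other_rows_unwritten _ _ M2 M1 c K Hc HO2.
    split; first by move=> a Ha; rewrite U2 // HO.
    (* The traversal may choose a row twice, namely once every row coincides with a chosen one; an
       earlier index can then name the row just written. *)
    move=> u' Hu'; case: (eqVneq c (nth 0 cs u')) => [<-|N]; first exact: HF.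
    have Hu'' : u' < u by case: (ltngtP u' u) => // [|E]; [lia|rewrite E eqxx in N].
    apply: (other_rows_done K Hc _ N HO2); last exact: HD.
    by apply: Hcs; rewrite mem_nth // Hs; lia.
  by rewrite /=; nia.
- move=> rg' M' O [HO HD]; split=> // c Hc.
  by rewrite -(nth_index 0 Hc); apply: HD; rewrite -Hs index_mem.
rewrite sum_nat_const card_ord.
have : 0 < tm d * tq d by rewrite muln_gt0 m0.
nia.
Qed.

Lemma correct_row_correct W d X Y i c rg M :
  task_ok W d -> params d rg -> inputs d M X Y -> i < tn d -> c < tn d ->
  rg fi = i -> rg fc = c ->
  (forall j, j < tm d -> M (adr d i j) = dotn (tq d) (X c) (Y j)) ->
  tri W correct_row rg M (100 * tq d + 150 * (tm d * hamn (tq d) (X i) (X c)))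
  (fun rg' M' => [/\ forall x, x < 32 -> rg' x = rg x, other_rows d M' M i &
    row_done d M' X Y i]).
Proof.
move=> K HP HI Hi Hc Ei Ec HM.
have [q0 _ m0 KX KY Kout _ Kb KW] := K.
have PP := params_eqs HP.
apply: (@tri_for _ _ _ _ 32 (fun h rg' M' => other_rows d M' M i /\
   forall j, j < tm d -> M' (adr d i j) = mixn (tq d) h (X i) (X c) (Y j))
   (fun h => 80 + (X i h != X c h) * (100 * tm d)) (tq d)) => //.
- by rewrite PP.
- lia.
- move=> h rg1 M1 Hh Eh O [HO HD].
  have HP1 : params d rg1 by apply: params_frame HP _ => x Hx; rewrite O //; lia.
  have PP1 := params_eqs HP1.
  have Ei1 : rg1 fi = i by rewrite O.
  have Ec1 : rg1 fc = c by rewrite O.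
  have U1 := other_rows_unwritten K Hi HO.
  have [HX HY] := inputs_unwritten K HI U1.
  have Ai := KX _ _ Hi Hh; have Ac := KX _ _ Hc Hh.
  have mixE : forall j, mixn (tq d) h.+1 (X i) (X c) (Y j) =
      mixn (tq d) h (X i) (X c) (Y j) + X i h * Y j h - X c h * Y j h.
    by move=> j; rewrite -mixnS // addnK.
  eapply tri_le.
    apply: tri_seq; apply: tri_asg => //=; first by rewrite !PP1 Ei1 Eh; crush.
    rewrite /= !PP1 Ei1 Eh HX //.
    apply: tri_seq; apply: tri_asg => //=.
      by rewrite /upd /= !PP1 Ec1 Eh; crush.
    have -> : M1 (upd rg1 33 (X i h) 8 + upd rg1 33 (X i h) 31 * upd rg1 33 (X i h) 9 +
        upd rg1 33 (X i h) 32 * upd rg1 33 (X i h) 10) = X c h.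
      by rewrite /upd /= !PP1 Ec1 Eh HX.
    set rg2 := upd _ _ _.
    have O2 x : x < 33 -> rg2 x = rg1 x by move=> Hx; rewrite /rg2 !upd_other //; lia.
    have HP2 : params d rg2 by apply: params_frame HP1 _ => x Hx; rewrite O2 //; lia.
    have PP2 := params_eqs HP2.
    apply: tri_conseq.
    + apply: (@tri_when _ _ _ _ _ _ (fun rg' M' =>
        [/\ rg' fh = h, forall x, x < 32 -> rg' x = rg x, other_rows d M' M i &
        forall j, j < tm d -> M' (adr d i j) = mixn (tq d) h.+1 (X i) (X c) (Y j)])).
      * by rewrite /= /rg2 /upd /=; crush; case: (X _ _); case: (X _ _) => /=; lia.
      * move=> _; apply: tri_conseq (leqnn _) _.
          apply: (@row_loop_correct _ _ 35 _ (adr d i)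
            (fun j => mixn (tq d) h.+1 (X i) (X c) (Y j)) (tm d) 80) => //.
          -- by rewrite PP2.
          -- lia.
          -- by move=> j j' Hj Hj' E; have [] := task_inj K Hi Hi Hj Hj' E.
          -- move=> j rg3 M3 Hj Ej O3 HO3.
             have HP3 : params d rg3.
               by apply: params_frame HP2 _ => x Hx; rewrite O3 //; lia.
             have PP3 := params_eqs HP3.
             have Ei3 : rg3 fi = i by rewrite O3 // O2.
             have Eh3 : rg3 fh = h by rewrite O3 // O2.
             have Ex3 : rg3 fx = X i h by rewrite O3 // /rg2 upd_other // upd_same.
             have Ey3 : rg3 fy = X c h by rewrite O3 // /rg2 upd_same.
             have OR3 : other_rows d M3 M1 i.
               by move=> a Ha; rewrite HO3 // => j' Hj'; apply: Ha; lia.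
             have U3 := other_rows_unwritten K Hi OR3.
             have [HX3 HY3] := inputs_unwritten K (conj HX HY) U3.
             have Hout := Kout i j Hi Hj.
             have Hin := KY _ _ Hj Hh.
             have Hold : M3 (adr d i j) = mixn (tq d) h (X i) (X c) (Y j).
               rewrite HO3 ?HD // => j' Hj' E.
               by have [_ Ejj] := task_inj K Hi Hi Hj (ltn_trans Hj' Hj) E; lia.
             have Hle := mixn_le (tq d) h (X i) (X c) (Y j).
             rewrite /adr in Hout Hold.
             eapply tri_le.
               apply: tri_sto => /=.
               - by rewrite !PP3 Ei3 Ej; crush.
               - rewrite !PP3 Ei3 Ej Eh3 Ex3 Ey3 HY3 // Hold.
                 by crush; case: (X i h); case: (X c h); case: (Y _ _) => /=; lia.
               rewrite !PP3 Ei3 Ej Eh3 Ex3 Ey3 HY3 // Hold -mixE.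
               by split.
             by rewrite /=; lia.
        move=> rg4 M4 [O4 HF HO4]; split.
        -- by rewrite O4 // O2.
        -- by move=> x Hx; rewrite O4 ?O2 ?O //; lia.
        -- by move=> a Ha; rewrite HO4 // HO.
        -- exact: HF.
      * move=> /= E0; split=> //.
        -- by move=> x Hx; rewrite O2 ?O //; lia.
        -- move=> j Hj; rewrite mixE HD //.
           move: E0; rewrite /rg2 /upd /=.
           by case: (X i h); case: (X c h) => //= _; rewrite addnK.
    + apply: (_ : _ <= 30 + (X i h != X c h) * (100 * tm d)).
      rewrite /= /rg2 /upd /=.
      by case: (X i h); case: (X c h) => //=; lia.
    move=> rg4 M4 [E4 O4 OR4 HD4]; split=> //.
  by rewrite /=; lia.
- move=> rg' M' O [HO HD]; split=> //.
  by move=> j Hj; rewrite HD // mixnn.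
(* A pass over the row occurs only at a coordinate where the two rows differ; these indicators add
   up to [hamn]. *)
rewrite !big_split /= !sum_nat_const card_ord -big_distrl /= -/(hamn (tq d) (X i) (X c)).
by nia.
Qed.

(** Chosen rows are derived anew like all others. The invariant keeps them correct throughout, next
    to the rows already passed, so the neighbour of row [i] is always available. *)
Lemma derive_rows_correct W d X Y (cs : seq nat) D rg M :
  task_ok W d -> params d rg -> inputs d M X Y ->
  (forall a, a \in cs -> a < tn d) ->
  (forall c, c \in cs -> row_done d M X Y c) ->
  (forall i, i < tn d -> M (bE d + tn d + i) \in cs) ->
  (forall i, i < tn d -> hamn (tq d) (X i) (X (M (bE d + tn d + i))) <= D) ->
  tri W derive_rows rg M
    (200 * (tn d * tq d + tn d * tm d + tn d * tm d * D))
  (fun rg' M' => [/\ unwritten d M' M & forall i, i < tn d -> row_done d M' X Y i]).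
Proof.
move=> K HP HI Hcs Hseed Has HD.
have [q0 /andP[L0 HL] m0 KX KY Kout _ Kb KW] := K.
have PP := params_eqs HP.
apply: (@tri_for _ _ _ _ 30 (fun i rg' M' => unwritten d M' M /\
   forall i', i' < tn d -> i' < i \/ i' \in cs -> row_done d M' X Y i')
   (fun i => 50 + 80 * tm d + 100 * tq d + 150 * (tm d * D)) (tn d)) => //.
- by rewrite PP.
- lia.
- lia.
- by split=> // i' _ [//|]; apply: Hseed.
- move=> i rg1 M1 Hi Ei O [U1 HR].
  have HP1 := params_frame HP O; have PP1 := params_eqs HP1.
  have Ec := U1 (bE d + tn d + i); rewrite (_ : ~~ _) in Ec; last by lia.
  have {}Ec := Ec isT.
  set c := M (bE d + tn d + i) in Ec.
  have Hccs : c \in cs by apply: Has.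
  have Hc := Hcs _ Hccs.
  have Rc : row_done d M1 X Y c by apply: HR => //; right.
  eapply tri_le.
    apply: tri_seq; apply: tri_asg => //=; first by rewrite !PP1 Ei; crush.
    rewrite /= !PP1 Ei Ec.
    set rg2 := upd _ _ _.
    have HP2 : params d rg2.
      by apply: params_frame HP1 _ => x Hx; rewrite /rg2 upd_other //; lia.
    have PP2 := params_eqs HP2.
    apply: tri_seq; apply: tri_conseq (leqnn _) _.
      apply: (@row_loop_correct _ _ 32 _ (adr d i)
            (fun j => dotn (tq d) (X c) (Y j)) (tm d) 40) => //.
      + by rewrite PP2.
      + lia.
      + by move=> j j' Hj Hj' E; have [] := task_inj K Hi Hi Hj Hj' E.
      + move=> j rg3 M3 Hj Ej O3 HO3.
        have HP3 : params d rg3.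
          by apply: params_frame HP2 _ => x Hx; rewrite O3 //; lia.
        have PP3 := params_eqs HP3.
        have Ei3 : rg3 fi = i by rewrite O3 // /rg2 upd_other.
        have Ec3 : rg3 fc = c by rewrite O3 // /rg2 upd_same.
        have Hold : M3 (adr d c j) = dotn (tq d) (X c) (Y j).
          (* This covers [c = i] as well: only cells of earlier columns have been overwritten. *)
          rewrite HO3 ?Rc // => j' Hj' E.
          by have [_ Ejj] := task_inj K Hc Hi Hj (ltn_trans Hj' Hj) E; lia.
        have Hout := Kout i j Hi Hj; have Hout' := Kout c j Hc Hj.
        rewrite /adr in Hout Hout' Hold.
        eapply tri_le.
          apply: tri_sto => /=.
          - by rewrite !PP3 Ei3 Ej; crush.
          - by rewrite !PP3 Ec3 Ej; crush.
          by rewrite !PP3 Ei3 Ec3 Ej Hold; split.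
        by rewrite /=; lia.
    move=> rg4 M4 [O4 HF HO4].
    have OR4 : other_rows d M4 M1 i by [].
    have U4 := other_rows_unwritten K Hi OR4.
    have HP4 : params d rg4.
      by apply: params_frame HP2 _ => x Hx; rewrite O4 //; lia.
    have I4 : inputs d M4 X Y.
      by apply: inputs_unwritten K HI _ => a Ha; rewrite U4 // U1.
    apply: tri_conseq (leqnn _) _.
      apply: (@correct_row_correct W d X Y i c) => //.
      + by rewrite O4 // /rg2 upd_other.
      + by rewrite O4 // /rg2 upd_same.
    move=> rg5 M5 [O5 OR5 R5]; split.
    + by rewrite O5 // O4 // /rg2 upd_other.
    + by move=> x Hx; rewrite O5 ?O4 /rg2 ?upd_other ?O //; lia.
    have U5 := other_rows_unwritten K Hi OR5.
    split; first by move=> a Ha; rewrite U5 // U4 // U1.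
    move=> i' Hi' Hor; case: (eqVneq i i') => [<-//|N].
    apply: (other_rows_done K Hi Hi' N OR5); apply: (other_rows_done K Hi Hi' N OR4).
    by apply: HR => //; case: Hor => [Hlt|]; [left; lia|right].
  have := HD _ Hi; rewrite -/c => Hd.
  have : tm d * hamn (tq d) (X i) (X c) <= tm d * D by rewrite leq_mul2l Hd orbT.
  by rewrite /=; lia.
- move=> rg' M' O [U1 HR]; split=> // i Hi; apply: HR => //; by left.
rewrite sum_nat_const card_ord.
have : 0 < tn d * tq d by rewrite muln_gt0; lia.
nia.
Qed.

(** * The 2-approximation and the whole program *)

Lemma hamn_triangle q u v w : hamn q u v <= hamn q u w + hamn q v w.
Proof.
rewrite /hamn -big_split /=; apply: leq_sum => h _.
by case: (u h); case: (v h); case: (w h).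
Qed.

(* Pigeonhole: two of the [size cs + 1] spread-out rows share a centre. *)
Lemma traversal_radius (T : finType) (S : {set T}) (g : T -> nat -> bool) (f : nat -> T)
    q n X cs E As c best D :
  traversal q n X cs E As c best -> #|S| <= size cs ->
  (forall i, i < n -> f i \in S /\ hamn q (X i) (g (f i)) <= D) ->
  q.+1 <= best + 2 * D.
Proof.
move=> G HS Hf; case: (leqP q.+1 (best + 2 * D)) => // Hlt.
have Hrows : {in rcons cs c, forall a, a < n} by move=> a; apply: (trv_rows G).
have U : uniq (map f (rcons cs c)).
  rewrite uniq_pairwise pairwise_map.
  apply: (@sub_in_pairwise _ (fun a => a < n) _ _ _ _ _ (trv_spread G)); last first.
    by apply/allP => a; exact: Hrows.
  move=> a b Ha Hb /= Hab; apply/eqP => Eab.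
  have [_ Da] := Hf _ Ha; have [_ Db] := Hf _ Hb.
  have := hamn_triangle q (X a) (X b) (g (f a)).
  by rewrite {2}Eab; lia.
have Hsub : {subset map f (rcons cs c) <= enum S}.
  by move=> y /mapP[a /Hrows Ha ->]; rewrite mem_enum; have [] := Hf _ Ha.
have := uniq_leq_size U Hsub; rewrite size_map size_rcons -cardE; lia.
Qed.

Lemma bigmin_le (I : finType) (P : pred I) (F : I -> nat) q D :
  D <= q -> (forall i, P i -> D <= F i) -> D <= \big[minn/q]_(i | P i) F i.
Proof.
by move=> Hq HF; apply: (big_ind (fun x => D <= x)) => // x y; rewrite leq_min => -> ->.
Qed.

Definition ext q (u : 'I_q -> bool) (h : nat) : bool :=
  if insub h is Some h' then u h' else false.

Lemma ham_hamn q (u v : 'I_q -> bool) : ham u v = hamn q (ext u) (ext v).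
Proof.
rewrite /ham -sum1_card big_mkcond; apply: eq_bigr => h _.
by rewrite /ext !valK inE.
Qed.

(** An arbitrary family [rw] serves rows and columns alike. The bound is proved for every admissible
    [T], so no optimal set has to be extracted from the minimum. *)
Lemma traversal_lambda q n l (rw : 'I_n -> 'I_q -> bool) (X : nat -> nat -> bool) cs E As c best :
  (forall (i : 'I_n) (h : 'I_q), X i h = rw i h) ->
  traversal q n X cs E As c best -> size cs = l -> 0 < n -> 0 < best ->
  q.+1 - best <= 2 * \big[minn/q]_(T : {set {ffun 'I_q -> bool}} | #|T| <= l)
     \max_(i < n) \big[minn/q]_(u in T) ham (rw i) u.
Proof.
move=> HX G Hs n0 b0.
apply: (big_ind (fun x => q.+1 - best <= 2 * x)); first by lia.
  by move=> x y; lia.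
move=> T HT; set D := \max_(i < n) _.
(* For empty [T] every inner minimum is its unit [q], and [q.+1 - best <= q] because [best] is
   positive. *)
case: (set_0Vmem T) => [ET|[u0 Hu0]].
  have : q <= D.
    apply: leq_trans (leq_bigmax (Ordinal n0)).
    by apply: bigmin_le => // u; rewrite ET inE.
  by lia.
have ham_le i u : ham (rw i) u <= q by rewrite ham_hamn hamn_le.
pose f i : {ffun 'I_q -> bool} :=
  if insub i is Some i' then [arg min_(u < u0 in T) ham (rw i') u] else u0.
suff : q.+1 <= best + 2 * D by lia.
apply: (@traversal_radius _ T (fun u => ext u) f) G _ _; first by rewrite Hs.
have hamE (i : 'I_n) (u : 'I_q -> bool) : hamn q (X i) (ext u) = ham (rw i) u.
  by rewrite ham_hamn; apply: eq_bigr => h _; rewrite HX /ext !valK.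
move=> i Hi; rewrite /f -[i]/(val (Ordinal Hi)) valK hamE.
case: arg_minnP => // u Hu Hmin; split=> //.
apply: leq_trans (leq_bigmax (Ordinal Hi)).
exact: bigmin_le.
Qed.

(** Distances are at most [q], so one chosen row lifts every closeness above 0. This rules out the
    unassigned case of [trv_assigned]. *)
Lemma traversal_best_gt0 q n X cs E As c best :
  traversal q n X cs E As c best -> 0 < size cs -> 0 < best.
Proof.
move=> G Hs.
have Hc : c < n by apply: (trv_rows G); rewrite mem_rcons mem_head.
have H0 : nth 0 cs 0 \in cs by rewrite mem_nth.
rewrite -(trv_next G); have := trv_nearest G Hc H0.
by have := hamn_le q (X c) (X (nth 0 cs 0)); lia.
Qed.

Definition traversed d M X best : Prop :=
  exists cs c, [/\ size cs = tL d,
    forall u, u < tL d -> M (bE d + tn d + tn d + u) = nth 0 cs u &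
    traversal (tq d) (tn d) X cs (fun i => M (bE d + i))
      (fun i => M (bE d + tn d + i)) c best].

Lemma traversed_frame d M M' X best :
  traversed d M X best -> tL d <= tn d ->
  (forall a, bE d <= a < bE d + 3 * tn d -> M' a = M a) -> traversed d M' X best.
Proof.
move=> [cs [c [Hs Hcs [H1 H2 H3 H4 H5 H6]]]] HL HO; exists cs, c; split=> //.
  by move=> u Hu; rewrite HO ?Hcs //; lia.
have Hc : c < tn d by apply: H5; rewrite mem_rcons mem_head.
split=> //.
- by move=> i Hi; rewrite !HO; [exact: H1|lia..].
- by move=> i a Hi Ha; rewrite !HO; [exact: H2|lia..].
- by move=> i Hi; rewrite !HO; [exact: H3|lia..].
- by rewrite HO //; lia.
Qed.

Definition multiply : cmd := seed_rows ;; derive_rows.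

Lemma multiply_correct W d X Y best rg M :
  task_ok W d -> params d rg -> inputs d M X Y -> traversed d M X best ->
  tri W multiply rg M
    (200 * (tL d * tm d * tq d) +
     200 * (tn d * tq d + tn d * tm d + tn d * tm d * ((tq d).+1 - best)))
    (fun rg' M' => forall i, i < tn d -> row_done d M' X Y i).
Proof.
move=> K HP HI [cs [c [Hs Hcs G]]].
have [_ /andP[L0 HL] _ _ _ _ _ Kb _] := K.
have Hn a : a \in cs -> a < tn d.
  by move=> Ha; apply: (trv_rows G); rewrite mem_rcons inE Ha orbT.
have b0 : 0 < best by apply: traversal_best_gt0 G _; rewrite Hs.
have As_ok i : i < tn d -> M (bE d + tn d + i) \in cs /\
    hamn (tq d) (X i) (X (M (bE d + tn d + i))) <= (tq d).+1 - best.
  move=> Hi; have := trv_best G Hi.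
  by case: (trv_assigned G Hi) => [->|[Ha Hd]] Hb; [lia|split=> //; lia].
apply: tri_seq; apply: tri_conseq (seed_rows_correct K HP HI Hs Hn Hcs) (leqnn _) _.
move=> rg1 M1 [O1 U1 HD].
have HA i : i < tn d -> M1 (bE d + tn d + i) = M (bE d + tn d + i).
  by move=> Hi; rewrite U1 //; lia.
apply: tri_conseq.
- apply: (derive_rows_correct K (params_frame HP O1) (inputs_unwritten K HI U1) Hn HD).
  + by move=> i Hi; rewrite HA //; case: (As_ok i Hi).
  + by move=> i Hi; rewrite HA //; case: (As_ok i Hi) => _; exact.
- exact: leqnn.
- by move=> rg' M' [].
Qed.

Lemma traverse_correct W d X Y rg M :
  task_ok W d -> params d rg -> inputs d M X Y ->
  (forall i, i < tn d -> M (bE d + i) = 0) ->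
  tri W gonz rg M (400 * tL d * tn d * tq d) (fun rg' M' =>
    [/\ forall x, x < 30 -> rg' x = rg x,
      forall a, ~~ (bE d <= a < bE d + 3 * tn d) -> M' a = M a &
      traversed d M' X (rg' gbest)]).
Proof.
move=> K HP [HX _] HM.
have [q0 L0 m0 KX _ _ _ Kb KW] := K; have PP := params_eqs HP.
apply: tri_conseq (leqnn _) _.
  apply: (gonz_correct HX (bE := bE d)); rewrite ?PP //; try lia.
  by move=> i h Hi Hh; have := KX _ _ Hi Hh; lia.
move=> rg' M' [cs [c [Hs O HO Hcs G]]]; split=> //.
by exists cs, c; split.
Qed.

(** * The row task, the column task and the choice between them *)

Notation vbestB := 18 (only parsing).
Notation vbestA := 19 (only parsing).

Definition set_rows : cmd :=
  Asg vn $vp ;; Asg vm $vr ;; Asg vL $vl ;;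
  Asg vBX #0 ;; Asg vSX $vq ;; Asg vTX #1 ;;
  Asg vBY ($vp * $vq) ;; Asg vSY #1 ;; Asg vTY $vr ;;
  Asg vO ($vp * $vq + $vq * $vr) ;; Asg vOX $vr ;; Asg vOY #1 ;;
  Asg vE ($vp * $vq + $vq * $vr + $vp * $vr).

Definition set_cols : cmd :=
  Asg vn $vr ;; Asg vm $vp ;; Asg vL $vk ;;
  Asg vBX ($vp * $vq) ;; Asg vSX #1 ;; Asg vTX $vr ;;
  Asg vBY #0 ;; Asg vSY $vq ;; Asg vTY #1 ;;
  Asg vO ($vp * $vq + $vq * $vr) ;; Asg vOX #1 ;; Asg vOY $vr ;;
  Asg vE ($vp * $vq + $vq * $vr + $vp * $vr + $vp + $vp + $vp).

Definition task_rows p q r l : task :=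
  Task p r l q 0 q 1 (p * q) 1 r (p * q + q * r) r 1 (p * q + q * r + p * r).

(** Swapped strides present both factors and the result as transposed. The scratch area starts [3p]
    cells later, past the tables of the row traversal, so both traversals are still in memory when
    the costs are compared. *)
Definition task_cols p q r k : task :=
  Task r p k q (p * q) 1 r 0 q 1 (p * q + q * r) 1 r
    (p * q + q * r + p * r + p + p + p).

Definition row_cost : expr :=
  ($vp * $vr * ($vq + #1 - $vbestA) + $vr * $vq * $vl)%E.
Definition col_cost : expr :=
  ($vp * $vr * ($vq + #1 - $vbestB) + $vp * $vq * $vk)%E.

(** The outer test skips everything when [q] is 0, where loops over coordinates would still run
    once. The rows are set up last, so the parameters change again only if their cost is strictly
    larger. *)
Definition main : cmd :=
  When $vq (
    set_cols ;; gonz ;; Asg vbestB $gbest ;;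
    set_rows ;; gonz ;; Asg vbestA $gbest ;;
    When (row_cost - col_cost) set_cols ;;
    multiply).

Definition dims p q r l k (rg : nat -> nat) : Prop :=
  [/\ rg vp = p, rg vq = q, rg vr = r & rg vl = l /\ rg vk = k].

Lemma dims_le p q r : 0 < p -> 0 < q -> [/\ p <= p * q, q <= p * q & r <= p * r].
Proof. by move=> p0 q0; rewrite leq_pmulr ?leq_pmull. Qed.

(** Room for all addresses: for positive dimensions, the scratch areas of lengths [3p] and [3r] are
    bounded by multiples of the sizes of the matrices. *)
Definition word_ok W p q r := 10 * (p * q + q * r + p * r) + 3 < W.

Lemma set_rows_correct W p q r l k rg M :
  dims p q r l k rg -> 0 < p -> 0 < q -> 0 < r -> word_ok W p q r ->
  tri W set_rows rg M 100 (fun rg' M' =>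
    [/\ params (task_rows p q r l) rg', dims p q r l k rg',
       rg' vbestB = rg vbestB, rg' vbestA = rg vbestA & M' = M]).
Proof.
move=> [Ep Eq Er [El Ek]] p0 q0 r0 HW; rewrite /word_ok in HW.
have [Hp Hq Hr] := dims_le r p0 q0.
eapply tri_le.
  do 12 (apply: tri_seq; apply: tri_asg;
    [by []|by rewrite /upd /= ?Ep ?Eq ?Er ?El ?Ek; repeat split; lia|]).
  apply: tri_asg; [by []|by rewrite /upd /= ?Ep ?Eq ?Er ?El ?Ek; repeat split; lia|].
  by rewrite /upd /=; split; rewrite ?/params ?/dims /= ?Ep ?Eq ?Er ?El ?Ek.
by [].
Qed.

Lemma set_cols_correct W p q r l k rg M :
  dims p q r l k rg -> 0 < p -> 0 < q -> 0 < r -> word_ok W p q r ->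
  tri W set_cols rg M 100 (fun rg' M' =>
    [/\ params (task_cols p q r k) rg', dims p q r l k rg',
       rg' vbestB = rg vbestB, rg' vbestA = rg vbestA & M' = M]).
Proof.
move=> [Ep Eq Er [El Ek]] p0 q0 r0 HW; rewrite /word_ok in HW.
have [Hp Hq Hr] := dims_le r p0 q0.
eapply tri_le.
  do 12 (apply: tri_seq; apply: tri_asg;
    [by []|by rewrite /upd /= ?Ep ?Eq ?Er ?El ?Ek; repeat split; lia|]).
  apply: tri_asg; [by []|by rewrite /upd /= ?Ep ?Eq ?Er ?El ?Ek; repeat split; lia|].
  by rewrite /upd /=; split; rewrite ?/params ?/dims /= ?Ep ?Eq ?Er ?El ?Ek.
by [].
Qed.

Lemma dotnC q u v : dotn q u v = dotn q v u.
Proof. by apply: eq_bigr => h _; rewrite mulnC. Qed.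

Lemma cell_lt p q i h : i < p -> h < q -> i * q + h < p * q.
Proof.
move=> Hi Hh; apply: (@leq_trans (i.+1 * q)); first by rewrite mulSn; lia.
by rewrite leq_mul2r Hi orbT.
Qed.

Lemma cell_inj q i i' h h' : h < q -> h' < q ->
  i * q + h = i' * q + h' -> i = i' /\ h = h'.
Proof.
move=> Hh Hh' E; have q0 : 0 < q by lia.
have Ei : i = i' by have := congr1 (divn^~ q) E; rewrite !divnMDl // !divn_small // !addn0.
by split=> //; move: E; rewrite Ei => /addnI.
Qed.

Lemma task_rows_ok W p q r l : 0 < q -> 0 < l <= p -> 0 < r -> word_ok W p q r ->
  task_ok W (task_rows p q r l).
Proof.
move=> q0 Hl r0; have p0 : 0 < p by lia.
have [Hp Hq Hr] := dims_le r p0 q0.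
rewrite /word_ok => HW; split=> //=.
- by move=> i h Hi Hh; have := cell_lt Hi Hh; lia.
- by move=> j h Hj Hh; have := cell_lt Hh Hj; lia.
- by move=> i j Hi Hj; rewrite /adr /=; have := cell_lt Hi Hj; lia.
- move=> i i' j j' Hi Hi' Hj Hj'; rewrite /adr /= !muln1 -!addnA => /addnI /addnI.
  exact: cell_inj.
- lia.
- lia.
Qed.

Lemma task_cols_ok W p q r k : 0 < q -> 0 < k <= r -> 0 < p -> word_ok W p q r ->
  task_ok W (task_cols p q r k).
Proof.
move=> q0 Hk p0; have r0 : 0 < r by lia.
have [Hp Hq Hr] := dims_le r p0 q0.
rewrite /word_ok => HW; split=> //=.
- by move=> j h Hj Hh; have := cell_lt Hh Hj; lia.
- by move=> i h Hi Hh; have := cell_lt Hi Hh; lia.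
- by move=> j i Hj Hi; rewrite /adr /=; have := cell_lt Hi Hj; lia.
- move=> j j' i i' Hj Hj' Hi Hi'; rewrite /adr /= !muln1 -!addnA => /addnI /addnI.
  by rewrite ![_ + _ * r]addnC => /(cell_inj Hj Hj') [].
- lia.
- lia.
Qed.

(** * The initial memory and the whole program *)

Definition entry p q (A : 'M[bool]_(p, q)) (i h : nat) : bool :=
  if insub i is Some i' then ext (fun h => A i' h) h else false.

Lemma entryE p q (A : 'M[bool]_(p, q)) (i : 'I_p) (h : 'I_q) : entry A i h = A i h.
Proof. by rewrite /entry /ext !valK. Qed.

Lemma init_memA p q r (A : 'M[bool]_(p, q)) (B : 'M[bool]_(q, r)) i h :
  i < p -> h < q -> init_mem A B (i * q + h) = entry A i h.
Proof.
move=> Hi Hh; rewrite /init_mem cell_lt //; congr (nat_of_bool _).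
rewrite -[i in RHS]/(val (Ordinal Hi)) -[h in RHS]/(val (Ordinal Hh)) entryE.
apply/existsP/idP => [[i' /existsP[h' /andP[/eqP E]]]|HA].
  have [Ei Eh] := cell_inj Hh (ltn_ord h') E.
  by congr (is_true (A _ _)); apply: val_inj.
by exists (Ordinal Hi); apply/existsP; exists (Ordinal Hh); rewrite eqxx.
Qed.

Lemma init_memB p q r (A : 'M[bool]_(p, q)) (B : 'M[bool]_(q, r)) h j :
  h < q -> j < r -> init_mem A B (p * q + (h * r + j)) = entry B h j.
Proof.
move=> Hh Hj; rewrite /init_mem ltnNge leq_addr /= ltn_add2l cell_lt //.
congr (nat_of_bool _).
rewrite -[h in RHS]/(val (Ordinal Hh)) -[j in RHS]/(val (Ordinal Hj)) entryE.
apply/existsP/idP => [[h' /existsP[j' /andP[]]]|HB].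
  rewrite -addnA => /eqP /addnI E; have [Eh Ej] := cell_inj Hj (ltn_ord j') E.
  by congr (is_true (B _ _)); apply: val_inj.
by exists (Ordinal Hh); apply/existsP; exists (Ordinal Hj); rewrite addnA eqxx.
Qed.

Lemma init_mem0 p q r (A : 'M[bool]_(p, q)) (B : 'M[bool]_(q, r)) a :
  p * q + q * r <= a -> init_mem A B a = 0.
Proof. by move=> Ha; rewrite /init_mem !ifF //; lia. Qed.

Lemma inputs_rows p q r l (M : nat -> nat) (X Y : nat -> nat -> bool) :
  (forall i h, i < p -> h < q -> M (i * q + h) = X i h) ->
  (forall h j, h < q -> j < r -> M (p * q + (h * r + j)) = Y j h) ->
  inputs (task_rows p q r l) M X Y.
Proof.
move=> HX HY; split=> i h Hi Hh /=; rewrite ?muln1 ?add0n; first exact: HX.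
by rewrite -addnA [_ + _ * r]addnC HY.
Qed.

Lemma inputs_cols p q r k (M : nat -> nat) (X Y : nat -> nat -> bool) :
  (forall i h, i < p -> h < q -> M (i * q + h) = X i h) ->
  (forall h j, h < q -> j < r -> M (p * q + (h * r + j)) = Y j h) ->
  inputs (task_cols p q r k) M Y X.
Proof.
move=> HX HY; split=> i h Hi Hh /=; rewrite ?muln1 ?add0n; last exact: HX.
by rewrite -addnA [_ + _ * r]addnC HY.
Qed.

Lemma dims_frame p q r l k rg rg' : dims p q r l k rg ->
  (forall x, x < 30 -> rg' x = rg x) -> dims p q r l k rg'.
Proof. by move=> H O; rewrite /dims !O. Qed.

(** The numbers [dX] and [dY] stand for any bounds on the radii that traversals can produce. The
    second condition on [W] lets the machine evaluate both costs without wrapping around. *)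
Lemma main_correct W p q r l k (X Y : nat -> nat -> bool) rg (M : nat -> nat) :
  dims p q r l k rg -> 0 < q -> 0 < l <= p -> 0 < k <= r ->
  word_ok W p q r -> p * r * q.+1 + p * q * r < W ->
  (forall i h, i < p -> h < q -> M (i * q + h) = X i h) ->
  (forall h j, h < q -> j < r -> M (p * q + (h * r + j)) = Y j h) ->
  (forall a, p * q + q * r <= a -> M a = 0) ->
  forall dX dY,
  (forall cs E As c best, traversal q p X cs E As c best -> size cs = l -> 
     q.+1 - best <= dX) ->
  (forall cs E As c best, traversal q r Y cs E As c best -> size cs = k -> 
     q.+1 - best <= dY) ->
  tri W main rg M (1000 * (p * r + p * q * l + r * q * k +
     minn (p * r * dX + r * q * l) (p * r * dY + p * q * k)))
   (fun rg' M' => forall i j, i < p -> j < r ->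
    M' (p * q + q * r + i * r + j) = dotn q (X i) (Y j)).
Proof.
move=> HD q0 Hl Hk HW HW2 HX HY H0 dX dY HdX HdY.
have p0 : 0 < p by lia.
have r0 : 0 < r by lia.
have KA := task_rows_ok q0 Hl r0 HW; have KB := task_cols_ok q0 Hk p0 HW.
have pr0 : 0 < p * r by rewrite muln_gt0 p0.
have Hlq : r * q * l <= p * q * r.
  by rewrite (_ : p * q * r = r * q * p); [rewrite leq_mul2l|]; lia.
have Hkq : p * q * k <= p * q * r by rewrite leq_mul2l; lia.
have word : forall d, p * r * (q.+1 - d) <= p * r * q.+1.
  by move=> d; rewrite leq_mul2l leq_subr orbT.
pose mX := p * r * dX + r * q * l.
pose mY := p * r * dY + p * q * k.
have Eq : rg vq = q by case: HD.
eapply tri_le.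
  apply: tri_when => /= [//|_|E0]; last by rewrite E0 in Eq; lia.
  apply: tri_seq; apply: tri_conseq (set_cols_correct M HD p0 q0 r0 HW) (leqnn _) _.
  move=> rg1 _ [P1 D1 _ _ ->].
  apply: tri_seq; apply: tri_conseq (leqnn _) _.
    apply: (traverse_correct KB P1 (inputs_cols k HX HY)).
    by move=> i Hi /=; apply: H0; lia.
  move=> rg2 M2 [O2 U2 T2].
  have D2 := dims_frame D1 O2.
  apply: tri_seq; apply: tri_asg => //.
  set bestB := rg2 gbest in T2 *.
  change (eval _ _ _) with bestB.
  have D3 : dims p q r l k (upd rg2 vbestB bestB) by [].
  apply: tri_seq; apply: tri_conseq (set_rows_correct M2 D3 p0 q0 r0 HW) (leqnn _) _.
  move=> rg4 _ [P4 D4 B4 _ ->].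
  rewrite upd_same in B4.
  have X2 i h : i < p -> h < q -> M2 (i * q + h) = X i h.
    by move=> Hi Hh; rewrite U2 ?HX //=; have := cell_lt Hi Hh; lia.
  have Y2 h j : h < q -> j < r -> M2 (p * q + (h * r + j)) = Y j h.
    by move=> Hh Hj; rewrite U2 ?HY //=; have := cell_lt Hh Hj; lia.
  apply: tri_seq; apply: tri_conseq (leqnn _) _.
    apply: (traverse_correct KA P4 (inputs_rows l X2 Y2)).
    by move=> i Hi /=; rewrite /= in Hi; rewrite U2 /= ?H0 //; lia.
  move=> rg5 M5 [O5 U5 T5].
  have D5 := dims_frame D4 O5; have P5 := params_frame P4 O5.
  set bestA := rg5 gbest in T5 *.
  have X5 i h : i < p -> h < q -> M5 (i * q + h) = X i h.
    by move=> Hi Hh; rewrite U5 ?X2 //=; have := cell_lt Hi Hh; lia.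
  have Y5 h j : h < q -> j < r -> M5 (p * q + (h * r + j)) = Y j h.
    by move=> Hh Hj; rewrite U5 ?Y2 //=; have := cell_lt Hh Hj; lia.
  have T5' : traversed (task_cols p q r k) M5 Y bestB.
    by apply: traversed_frame T2 _ _ => /=; [lia|move=> a Ha; rewrite U5 //=; lia].
  have dA : q.+1 - bestA <= dX by case: T5 => cs [c [Hs _ G]]; exact: HdX G Hs.
  have dB : q.+1 - bestB <= dY by case: T2 => cs [c [Hs _ G]]; exact: HdY G Hs.
  apply: tri_seq; apply: tri_asg => //.
  change (eval _ _ _) with bestA.
  set rg6 := upd rg5 _ _.
  have D6 : dims p q r l k rg6 by [].
  have P6 : params (task_rows p q r l) rg6 by [].
  have [Ep6 Eq6 Er6 [El6 Ek6]] := D6.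
  have Eb6 : rg6 vbestB = bestB by rewrite /rg6 upd_other // O5.
  have Ea6 : rg6 vbestA = bestA by rewrite /rg6 upd_same.
  pose cA := p * r * (q.+1 - bestA) + r * q * l.
  pose cB := p * r * (q.+1 - bestB) + p * q * k.
  have EA : eval rg6 M5 row_cost = cA by rewrite /= Ep6 Eq6 Er6 El6 Ea6 addn1.
  have EB : eval rg6 M5 col_cost = cB by rewrite /= Ep6 Eq6 Er6 Ek6 Eb6 addn1.
  have ED : eval rg6 M5 (row_cost - col_cost)%E = cA - cB by rewrite -EA -EB.
  have wA := word bestA; have wB := word bestB.
  have Hpr : p * r <= p * r * q.+1 by rewrite leq_pmulr.
  have Hrq : r * q <= p * q * r by rewrite (_ : p * q * r = p * (r * q)); [rewrite leq_pmull|]; lia.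
  have Hpq : p * q <= p * q * r by rewrite leq_pmulr.
  have Hq1 : q.+1 <= p * r * q.+1 by rewrite leq_pmull.
  apply: tri_seq; apply: tri_conseq.
  - apply: (@tri_when _ _ _ _ _ 100 (fun rg' M' => M' = M5 /\
      (params (task_rows p q r l) rg' /\ cA <= cB \/
       params (task_cols p q r k) rg' /\ cB <= cA))).
    + rewrite /= Ep6 Eq6 Er6 El6 Ek6 Eb6 Ea6 !addn1.
      by repeat split; lia.
    + rewrite ED => Hlt.
      apply: tri_conseq (set_cols_correct M5 D6 p0 q0 r0 HW) (leqnn _) _.
      by move=> rg8 _ [P8 _ _ _ ->]; split=> //; right; split=> //; lia.
    + rewrite ED => Hlt.
      by split=> //; left; split=> //; lia.
  - by apply: leq_add (leqnn _) (leq_mul (leq_b1 _) (leqnn _)).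
  move=> rg7 _ [-> HP7].
  (* The program compares the measured costs [cA] and [cB], not their bounds; as each is at most its
     bound, the smaller one is at most [minn mX mY]. *)
  have cAX : cA <= mX by rewrite leq_add2r leq_mul2l dA orbT.
  have cBY : cB <= mY by rewrite leq_add2r leq_mul2l dB orbT.
  apply: (@tri_le _ _ _ _ (200 * (minn mX mY + p * q * l + r * q * k + p * r))).
  - case: HP7 => [[P7 Hc]|[P7 Hc]].
    + apply: tri_conseq (multiply_correct KA P7 (inputs_rows l X5 Y5) T5) _ _ => /=.
        (* Scanning the coordinates of all rows is charged to the term of the traversal. *)
        have : p * q <= p * q * l by rewrite leq_pmulr; lia.
        have : cA <= minn mX mY by lia.
        rewrite {1}/cA; lia.
      move=> rg8 M8 HR i j Hi Hj; rewrite -(HR i Hi j Hj) /adr /= muln1.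
      by congr M8; lia.
    + apply: tri_conseq (multiply_correct KB P7 (inputs_cols k X5 Y5) T5') _ _ => /=.
        have : r * q <= r * q * k by rewrite leq_pmulr; lia.
        have : cB <= minn mX mY by lia.
        rewrite {1}/cB; lia.
      move=> rg8 M8 HR i j Hi Hj; rewrite dotnC -(HR j Hj i Hi) /adr /= muln1.
      by congr M8; lia.
  - exact: leqnn.
rewrite -/mX -/mY /=; lia.
Qed.

(** The compiled code runs off its end, where the default of [nth] is [IHalt]; any fuel left over is
    harmless. *)
Lemma tri_exec W c rg M N Q : tri W c rg M N Q ->
  exists rg' M', exec (compile 0 c) W N (Config 0 rg M) = Some M' /\ Q rg' M'.
Proof.
move=> H; have [|//|t [R' [rg' [M' [Ht q _ X]]]]] := H (compile 0 c) 0 rg; first by [].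
exists rg', M'; split=> //; rewrite -(subnKC Ht) X add0n.
by case: (N - t) => [|k] /=; rewrite nth_default // size_compile.
Qed.

Theorem theorem5 :
  exists (P : program) (c C : nat),
    forall (p q r : nat) (A : 'M[bool]_(p, q)) (B : 'M[bool]_(q, r)) (l k : nat),
      0 < l <= p -> 0 < k <= r ->
      exists M : nat -> nat,
        exec P (word_bound c p q r) (C * time_bound A B l k)
             (init_config A B l k) = Some M
        /\ forall (i : 'I_p) (j : 'I_r),
             M (out_addr p q r i j) = arith_prod_entry A B i j.
Proof.
(* With [n] the size of input and output, the costs are at most [n * n.+1 + n * n], and the exponent
   4 leaves ample room since [n + 2] is at least 5 when all dimensions are positive. The factor 2000
   is the 1000 of [main_correct] times the 2 of the approximation. *)
exists (compile 0 main), 4, 2000 => p q r A B l k Hl Hk.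
set W := word_bound _ _ _ _; set N := 2000 * _.
have p0 : 0 < p by lia.
have r0 : 0 < r by lia.
have pr0 : 0 < p * r by rewrite muln_gt0 p0.
suff H : tri W main (init_regs p q r l k) (init_mem A B) N (fun _ M' =>
    forall i j, i < p -> j < r ->
      M' (out_addr p q r i j) = dotn q (entry A i) (fun h => entry B h j)).
  have [rg' [M' [HE HM]]] := tri_exec H.
  exists M'; split=> // i j; rewrite HM // /dotn /arith_prod_entry.
  by apply: eq_bigr => h _; rewrite !entryE.
have HN : 2000 * (p * r) <= N by rewrite /N /time_bound; lia.
(* For [q = 0] the product is zero, and so are the untouched output cells. *)
case: (posnP q) => [Eq|q0].
  eapply tri_le.
    apply: (@tri_when _ _ _ _ _ 0) => /= [//|/(_ Eq)//|_] i j _ _.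
    rewrite init_mem0 /out_addr ?leq_addr; last by lia.
    by rewrite /dotn big1 // => h; have := ltn_ord h; lia.
  by rewrite /= Eq /=; lia.
have [Hp Hq Hr] := dims_le r p0 q0.
have HW : p * r * q.+1 + p * q * r < W /\ word_ok W p q r.
  rewrite /W /word_bound /word_ok; set n := p * q + q * r + p * r.
  have n3 : 2 < n by lia.
  have Hn : p * r * q.+1 <= n * n.+1 by apply: leq_mul; lia.
  have Hn' : p * q * r <= n * n by apply: leq_mul; lia.
  have : (n + 2) ^ 2 * 5 ^ 2 <= (n + 2) ^ 4.
    by rewrite -[4]/(2 + 2) expnD leq_mul2l; apply/orP; right; rewrite leq_exp2r //; lia.
  rewrite -mulnn; split; nia.
eapply tri_le.
  apply: (@main_correct W p q r l k (entry A) (fun j h => entry B h j) _ _ _ q0 Hl Hk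
    _ _ _ _ _ (2 * lambda_row A l) (2 * lambda_col B k)) => //.
  + by case: HW.
  + by case: HW.
  + by move=> i h; apply: init_memA.
  + by move=> h j; apply: init_memB.
  + by move=> a; apply: init_mem0.
  + move=> cs E As c best G Hs.
    apply: (traversal_lambda _ G Hs p0); last by apply: traversal_best_gt0 G _; lia.
    by move=> i h; rewrite entryE.
  + move=> cs E As c best G Hs.
    apply: (traversal_lambda _ G Hs r0); last by apply: traversal_best_gt0 G _; lia.
    by move=> j h; rewrite entryE.
by rewrite /N /time_bound; lia.
Qed.
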